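(* Let $\star\in\{\mathrm{rel},\mathrm{abs}\}$ and suppose that $(\mu,\rho,V,\mathcal L)$ is $\star$-admissible (relatively admissible if $\star=\mathrm{rel}$, absolutely admissible if $\star=\mathrm{abs}$). Define $$\Xi_\star(x)=\begin{cases}|\omega_{\mathcal L,\rho}(x)|,&\star=\mathrm{rel},\\ 1,&\star=\mathrm{abs}.\end{cases}$$ Then, for every $\sigma>0$ and every $0<\xi<1$, there exist $J\ge 1$ and an integer $M$ satisfying $$\frac{6QJ}{\sigma^2}\log\left(\frac{4N}{\xi}\right)\le M\le\frac{7QJ}{\sigma^2}\log\left(\frac{4N}{\xi}\right),$$ such that, with probability at least $1-\xi$ over independent samples $x_1,\dots,x_M\sim\rho$, the least squares quadrature rule is well-defined, exact on $V$, and satisfies $$\left|Mw_m-\omega_{\mathcal L,\rho}(x_m)\right|\le\sigma\,\Xi_\star(x_m),\qquad m=1,\dots,M.$$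
   Context: Setting. $\mu$ is a positive measure with closed support $D$ in a Banach space; functions on $D$ are $\mu$-measurable, complex-valued and pointwise defined. $\langle u,v\rangle=\int_D\overline{u}\,v\,d\mu$ and $\|\cdot\|$ are the inner product and norm of $L^2_\mu(D)$. $V\subset L^2_\mu(D)$ is a subspace of finite complex dimension $N\geq 1$; an $L^2_\mu$-orthonormal basis of $V$ is fixed, with fixed measurable pointwise representatives $\varphi_1,\dots,\varphi_N$, and $V$ is identified with the space of pointwise-defined functions $\sum_n c_n\varphi_n$. Write $\boldsymbol\varphi(x)=(\varphi_1(x),\dots,\varphi_N(x))^T$ and $k(x)=\sum_{n=1}^N|\varphi_n(x)|^2$. Sampling measure. $\tau^2:D\to[0,\infty)$ is measurable with $\int_D\tau^2\,d\mu=1$ and satisfies the coverage condition: $k(x)=0$ for $\mu$-almost every $x\in\{\tau^2=0\}$. $\rho$ is the probability measure $d\rho=\tau^2\,d\mu$, and $Q=\operatorname{ess\,sup}_{x\sim\rho}k(x)/\tau^2(x)$. Ratios of nonnegative quantities use the conventions $0/0=0$ and $a/0=+\infty$ for $a>0$. Functional. $\mathcal L\in V^*$ is a linear functional, $\ell_n=\mathcal L(\varphi_n)$, $\boldsymbol\ell=(\ell_1,\dots,\ell_N)^T$, $L=\sum_n\overline{\ell_n}\varphi_n\in V$ is its Riesz representer ($\mathcal L(v)=\langle L,v\rangle$ for $v\in V$), and $\|\mathcal L\|_{V^*}=\|L\|=\|\boldsymbol\ell\|_2$. The reference weight is $\omega_{\mathcal L,\rho}(x)=\overline{L(x)}/\tau^2(x)$,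 set to $0$ where $\tau^2(x)=0$. Least squares quadrature rule. For independent samples $x_1,\dots,x_M\sim\rho$, let $\mathbf G^{(M)}=\frac1M\sum_{m=1}^M\frac{\overline{\boldsymbol\varphi(x_m)}\,\boldsymbol\varphi(x_m)^T}{\tau^2(x_m)}$. The rule is well-defined if $\mathbf G^{(M)}$ is invertible; then its weights are $w_m=\frac{1}{M\tau^2(x_m)}\boldsymbol\ell^T(\mathbf G^{(M)})^{-1}\overline{\boldsymbol\varphi(x_m)}$ and $\mathcal Q_M(u)=\sum_{m=1}^Mw_mu(x_m)$. (Equivalently, $\mathcal Q_M(u)=\mathcal L(u_V^{(M)})$, where $u_V^{(M)}$ minimizes $\frac1M\sum_m|u(x_m)-v(x_m)|^2/\tau^2(x_m)$ over $v\in V$.) Exact on $V$ means $\mathcal Q_M(v)=\mathcal L(v)$ for all $v\in V$. Relative admissibility (for $\mathcal L\ne0$). Let $\cos\gamma(x)=\frac{|L(x)|}{\|\mathcal L\|_{V^*}\sqrt{k(x)}}$ if $k(x)>0$ and $\cos\gamma(x)=1$ if $k(x)=0$. For $J\geq1$ let $p_J=\Pr_{X\sim\rho}[1/\cos\gamma(X)\ge J^{1/2}]$. The tuple $(\mu,\rho,V,\mathcal L)$ is relatively admissible if $Q<\infty$ and $\lim_{J\to\infty}Jp_J=0$. Absolute admissibility. Let $A_{\mathcal L,\rho}(x)=\|\mathcal L\|_{V^*}\sqrt{k(x)}/\tau^2(x)$ and $q_J=\Pr_{X\sim\rho}[A_{\mathcal L,\rho}(X)\ge J^{1/2}]$. The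 tuple is absolutely admissible if $Q<\infty$ and $\lim_{J\to\infty}Jq_J=0$. *)

(* Defs.v *)
From HB Require Import structures.
From mathcomp Require Import all_boot all_order all_algebra.
From mathcomp Require Import all_classical all_reals all_analysis.
From mathcomp Require Import ess_sup_inf complex.

Set Implicit Arguments.
Unset Strict Implicit.
Unset Printing Implicit Defensive.

Import Order.TTheory GRing.Theory Num.Theory.
Import numFieldNormedType.Exports.

Local Open Scope classical_set_scope.
Local Open Scope ring_scope.
Local Open Scope complex_scope.

(* The real-valued modulus; the norm `|z| of R[i] is R[i]-valued. *)
Notation normc := ComplexField.Normc.normc.

(* Every sigma-algebra on E containing the open sets is <<s G >> for some such
   G: this covers the Borel sigma-algebra as well as its completions. *)
Definition contains_borel (E : topologicalType) (G : set (set E)) : Prop :=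
  [set U : set E | open U] `<=` <<s G >>.

Definition is_closed_support (R : realType) (E : completeNormedModType R)
    (G : set (set E)) (mu : {measure set (g_sigma_algebraType G) -> \bar R})
    (D : set E) : Prop :=
  [/\ closed D,
      mu (~` D) = 0%E
    & forall x, D x -> forall U : set E, open U -> U x -> (0 < mu U)%E].

(* a / b for a, b >= 0, with 0 / 0 = 0 and a / 0 = +oo for a > 0 *)
Definition nnratio (R : realType) (a b : R) : \bar R :=
  if b == 0 then if a == 0 then 0%E else +oo%E else (a / b)%:E.

Inductive mode := relative | absolute.

(* Functions on D are represented by total functions on the ambient space;
   their values outside D are irrelevant. *)
Section Setting.
Context {R : realType} {d : measure_display} {T : measurableType d}.
Implicit Types (mu : {measure set T -> \bar R}) (rho : probability T R).
Implicit Types (D : set T) (u v : T -> R[i]).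

Definition cmeasurable D u : Prop :=
  measurable_fun D (fun x => complex.Re (u x)) /\
  measurable_fun D (fun x => complex.Im (u x)).

Definition cintegral mu D u : R[i] :=
  (\int[mu]_(x in D) complex.Re (u x)) +i* (\int[mu]_(x in D) complex.Im (u x)).

Definition L2 mu D : set (T -> R[i]) :=
  [set u | cmeasurable D u /\
           (\int[mu]_(x in D) ((normc (u x)) ^+ 2)%:E < +oo)%E].

Definition inner mu D u v : R[i] := cintegral mu D (fun x => conjc (u x) * v x).

Definition L2norm mu D u : R := Num.sqrt (complex.Re (inner mu D u u)).

Definition is_density mu D rho (tau2 : T -> R) : Prop :=
  forall A, measurable A -> rho A = (\int[mu]_(x in D `&` A) (tau2 x)%:E)%E.

Section Space.
Context {N : nat} (phi : 'I_N -> T -> R[i]).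

Definition orthonormal_family mu D : Prop :=
  forall i j, inner mu D (phi i) (phi j) = (i == j)%:R.

Definition spanned : set (T -> R[i]) :=
  [set v | exists c : 'I_N -> R[i], v = fun x => \sum_n c n * phi n x].

Definition kfun (x : T) : R := \sum_n normc (phi n x) ^+ 2.

Definition coverage mu D (tau2 : T -> R) : Prop :=
  {ae mu, forall x, D x -> tau2 x = 0 -> kfun x = 0}.

Definition Qsup rho (tau2 : T -> R) : \bar R :=
  ess_sup rho (fun x => nnratio (kfun x) (tau2 x)).

(* F matters only on the span of phi. *)
Definition linear_on_span (F : (T -> R[i]) -> R[i]) : Prop :=
  forall a u v, spanned u -> spanned v ->
    F (fun x => a * u x + v x) = a * F u + F v.

Section Functional.
Context (F : (T -> R[i]) -> R[i]).

Definition dual_norm mu D : R :=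
  sup [set normc (F v) | v in [set v | spanned v /\ L2norm mu D v <= 1]].

Definition riesz (x : T) : R[i] := \sum_n conjc (F (phi n)) * phi n x.

Definition omega (tau2 : T -> R) (x : T) : R[i] :=
  if tau2 x == 0 then 0 else conjc (riesz x) / (tau2 x)%:C.

Definition cos_gamma mu D (x : T) : R :=
  if kfun x == 0 then 1
  else normc (riesz x) / (dual_norm mu D * Num.sqrt (kfun x)).

(* Intersecting with D, which has rho-measure 1, makes the event measurable:
   nothing is assumed about the functions outside D. *)
Definition p_rel mu D rho (J : R) : R :=
  fine (rho (D `&` [set x | ((Num.sqrt J)%:E <= nnratio 1 (cos_gamma mu D x))%E])).

Definition q_abs mu D rho (tau2 : T -> R) (J : R) : R :=
  fine (rho (D `&` [set x | ((Num.sqrt J)%:E <=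
    nnratio (dual_norm mu D * Num.sqrt (kfun x)) (tau2 x))%E])).

Definition admissible (s : mode) mu D rho (tau2 : T -> R) : Prop :=
  match s with
  | relative => [/\ exists2 v, spanned v & F v != 0,
               (Qsup rho tau2 < +oo)%E
             & J * p_rel mu D rho J @[J --> +oo] --> (0 : R)]
  | absolute => (Qsup rho tau2 < +oo)%E /\
           J * q_abs mu D rho tau2 J @[J --> +oo] --> (0 : R)
  end.

Definition Xi (s : mode) (tau2 : T -> R) (x : T) : R :=
  match s with relative => normc (omega tau2 x) | absolute => 1 end.

Section LeastSquares.
Context (tau2 : T -> R) {M : nat} (x : 'I_M -> T).

(* Division by tau2 (x m) = 0 gives 0 here; this is a rho-null event. *)
Definition gram : 'M[R[i]]_N :=
  \matrix_(i, j) (M%:R^-1 *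
    \sum_m (conjc (phi i (x m)) * phi j (x m) / (tau2 (x m))%:C)).

Definition ls_weight (m : 'I_M) : R[i] :=
  (M%:R * (tau2 (x m))%:C)^-1 *
  ((\row_n F (phi n)) *m invmx gram *m \col_n conjc (phi n (x m))) 0 0.

Definition ls_rule (u : T -> R[i]) : R[i] := \sum_m ls_weight m * u (x m).

Definition ls_well_defined : Prop := gram \in unitmx.

Definition exact_on_span : Prop := forall v, spanned v -> ls_rule v = F v.

End LeastSquares.
End Functional.
End Space.

Section Sampling.
Context {d' : measure_display} {Omega : measurableType d'}.
Context (P : probability Omega R).

Definition independent_samples rho (M : nat) (X : 'I_M -> {RV P >-> T}) : Prop :=
  (forall m A, measurable A -> distribution P (X m) A = rho A) /\
  (forall (I : {set 'I_M}) (B : 'I_M -> set T),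
    (forall m, measurable (B m)) ->
    P (\bigcap_(m in [set` I]) (X m @^-1` B m)) =
    (\prod_(m in I) P (X m @^-1` B m))%E).

(* For a measurable event S this says p <= P S. *)
Definition with_probability_at_least (p : R) (S : set Omega) : Prop :=
  exists A, [/\ measurable A, A `<=` S & (p%:E <= P A)%E].

End Sampling.
End Setting.

(* Main.v *)
Require Import Defs.
From HB Require Import structures.
From mathcomp Require Import all_boot all_order all_algebra.
From mathcomp Require Import all_classical all_reals all_analysis.
From mathcomp Require Import measurable_realfun ess_sup_inf complex.
From mathcomp Require Import ring lra.

(** Let [ell] be the row of coefficients of the functional, [G] the empirical
    Gram matrix and [e = ell G^-1 - ell].  At a sample point [x],
<<
      M w - omega = (e . conj phi (x)) / tau2 (x),
>>
    so the error is at most [|e| sqrt (k x) / tau2 x], and a bound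
    [|e| <= (sigma / sqrt J) |ell|] gives the claim at every sample outside the
    event counted by [p_J] or [q_J], which admissibility makes rare
    ([ls_weight_close], [not_tail_set]).  Everything thus hinges on the single
    vector [e], rather than on the operator norm of [G - 1].

    From [e = - ell (G - 1) - e (G - 1)] it suffices that [G - 1] has Frobenius
    norm at most [1 / 20] and that [|ell (G - 1)|] is at most
    [(19 / 20) (sigma / sqrt J) |ell|] ([invmx_gram_close]).  The first event
    has a failure probability that decays exponentially in [M], hence is
    negligible for large [J].  For the second, [ell G] is the mean of [M]
    independent copies of a bounded vector whose second moment is at most
    [Q |ell|^2], because the one-sample Gram matrix [g] satisfies
    [g^2 <= Q g] and has mean [1] ([sum_sample_gram_sq_le]).  Bernstein's
    inequality is applied to the [2 N] real coordinates with thresholds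
    essentially proportional to their standard deviations
    ([complex_family_tail_le]): all coordinates then have the same bound on
    their failure probability, while the squares of the thresholds add up to the
    budget for the whole vector.  As [M >= 6 Q J sigma^-2 ln (4 N / xi)] and the
    deviations are small compared with the bound on the vector, the common
    bound is [(xi / (4 N)) ^ (3 / 2)], which leaves room for suboptimal
    constants ([failure_budget]).

    Failure probabilities add up to [xi]: [xi / 2] for [ell G], [xi / 4] for
    the Frobenius norm, and [xi / 4] for a sample in the tail event, by a union
    bound and [J p_J -> 0] ([gram_inverse_concentration],
    [christoffel_quadrature]).

    The exponential moments factor over independent samples because a measure
    identity valid on indicators extends to nonnegative functions
    ([ge0_integral_transfer], [expectation_prod_independent]); the same
    extension principle moves integrals from [mu] to the sampling measure
    ([integral_density]). *)

Set Implicit Arguments.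
Unset Strict Implicit.
Unset Printing Implicit Defensive.

Import Order.TTheory GRing.Theory Num.Theory.
Import numFieldNormedType.Exports.
Import HBNNSimple ComplexField.Normc.

Local Open Scope classical_set_scope.
Local Open Scope ring_scope.
Local Open Scope complex_scope.

(** * Extension from indicators, and independence *)

(** Serves both as a change of density ([X] the identity, [H] a density) and as
    the induction step for independence ([P] a probability, [H] the product of
    the other factors).  Both sides are linear and monotonically continuous in
    [g], so agreement on indicators is enough. *)
Lemma ge0_integral_transfer (R : realType) d d' (T : measurableType d)
    (S : measurableType d') (P : {measure set S -> \bar R})
    (rho : {measure set T -> \bar R}) (D : set S) (X : S -> T) (H : S -> R)
    (c : R) (g : T -> R) :
  measurable D -> measurable_fun D X -> measurable_fun D H ->
  (forall x, D x -> 0 <= H x) -> 0 <= c ->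
  (forall B, measurable B ->
     (\int[P]_(x in D) (H x * \1_B (X x))%:E = c%:E * rho B)%E) ->
  measurable_fun setT g -> (forall x, 0 <= g x) ->
  (\int[P]_(x in D) (H x * g (X x))%:E = c%:E * \int[rho]_x (g x)%:E)%E.
Proof.
move=> mD mX mH H0 c0 HB mg g0.
have mg' : measurable_fun setT (EFin \o g) by exact/measurable_EFinP.
have g0' x : setT x -> (0 <= (EFin \o g : T -> \bar R) x)%E by rewrite lee_fin.
pose f_ := nnsfun_approx measurableT mg'.
have cg x : f_ n x @[n --> \oo] --> g x.
  by have /fine_cvg := cvg_nnsfun_approx measurableT mg' g0' (I : setT x).
have ndf x m n : (m <= n)%N -> f_ m x <= f_ n x.
  by move=> mn; exact/lefP/nd_nnsfun_approx.
transitivity (limn (fun n => \int[P]_(x in D) (H x * f_ n (X x))%:E))%E.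
  rewrite -monotone_convergence//.
  - apply: eq_integral => x /[!inE] xD; apply/esym/cvg_lim => //.
    apply: cvg_EFin; first by near=> n.
    by apply: cvgMr; exact: cg.
  - by move=> n; apply/measurable_EFinP/measurable_funM => //; exact: measurableT_comp.
  - by move=> n x Dx; rewrite lee_fin mulr_ge0 ?H0.
  - by move=> x Dx m n mn; rewrite lee_fin ler_wpM2l ?H0 ?ndf.
transitivity (limn (fun n => c%:E * \int[rho]_x (f_ n x)%:E))%E; last first.
  have -> : (fun n => c%:E * \int[rho]_x (f_ n x)%:E)%E =
      (fun n => \int[rho]_x (c * f_ n x)%:E)%E.
    apply/funext => n; rewrite -ge0_integralZl//.
      exact/measurable_EFinP.
    by move=> x _; rewrite lee_fin.
  rewrite -ge0_integralZl//.
  rewrite -monotone_convergence//.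
  - apply: eq_integral => x _; apply/cvg_lim => //.
    apply: cvg_EFin; first by near=> n.
    by apply: cvgMr; exact: cg.
  - by move=> n; apply/measurable_EFinP/measurable_funM.
  - by move=> n x Dx; rewrite lee_fin mulr_ge0.
  - by move=> x Dx m n mn; rewrite lee_fin ler_wpM2l ?ndf.
congr (limn _); apply/funext => n.
have mfk k : measurable (f_ n @^-1` [set k]).
  by rewrite -[X in measurable X]setTI; exact: measurable_funP.
rewrite integralT_nnsfun sintegralE ge0_mule_fsumr; last first.
  by move=> k; exact: nnsfun_mulemu_ge0.
transitivity (\sum_(k \in range (f_ n)) \int[P]_(x in D)
    (H x * (k * \1_(f_ n @^-1` [set k]) (X x)))%:E)%E.
  under eq_integral do rewrite fimfunE mulr_fsumr -fsumEFin//.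
  rewrite ge0_integral_fsum//.
  - move=> k; apply/measurable_EFinP/measurable_funM => //.
    apply: measurable_funM => //; apply: measurableT_comp => //.
  - move=> k x Dx; rewrite lee_fin mulr_ge0 ?H0//.
    by have := nnfun_muleindic_ge0 (f_ n) k (X x); rewrite -EFinM lee_fin.
apply: eq_fsbigr => k; rewrite inE => -[x _ <-{k}].
under eq_integral do rewrite mulrCA EFinM.
rewrite ge0_integralZl//.
- by rewrite HB// muleCA.
- apply/measurable_EFinP/measurable_funM => //; apply: measurableT_comp => //.
- by move=> y Dy; rewrite lee_fin mulr_ge0 ?H0.
- by rewrite lee_fin.
Unshelve. all: by end_near. Qed.

(** The hypothesis on [X] is this identity when all [g m] are indicators; they
    are replaced by general functions one index at a time. *)
Lemma expectation_prod_independent (R : realType) d d' (T : measurableType d)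
    (Omega : measurableType d') (P : probability Omega R)
    (rho : probability T R) (M : nat) (X : 'I_M -> {RV P >-> T})
    (g : 'I_M -> T -> R) (e : 'I_M -> R) :
  independent_samples rho X ->
  (forall m, measurable_fun setT (g m)) -> (forall m x, 0 <= g m x) ->
  (forall m, (\int[rho]_x (g m x)%:E = (e m)%:E)%E) ->
  (\int[P]_w (\prod_m g m (X m w))%:E = (\prod_m e m)%:E)%E.
Proof.
move=> [Xrho Xind].
(* only the factors of index below [k] are allowed not to be indicators *)
suff main k : (k <= M)%N -> forall (g : 'I_M -> T -> R) (e : 'I_M -> R),
    (forall m, measurable_fun setT (g m)) -> (forall m x, 0 <= g m x) ->
    (forall m, (\int[rho]_x (g m x)%:E = (e m)%:E)%E) ->
    (forall m : 'I_M, (k <= m)%N ->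
       exists2 B : set T, measurable B & g m = \1_B) ->
    (\int[P]_w (\prod_m g m (X m w))%:E = (\prod_m e m)%:E)%E.
  move=> mg g0 ge; apply: (main M) => // m.
  by rewrite leqNgt ltn_ord.
elim: k => [_|k IH kM] {}g {}e mg g0 ge gB.
  have /choice[B mB] : forall m, exists B : set T, measurable B /\ g m = \1_B.
    by move=> m; have [B ? ?] := gB m (leq0n _); exists B.
  have PB m : P (X m @^-1` B m) = (e m)%:E.
    have [mBm gm] := mB m.
    rewrite -[LHS]/(distribution P (X m) (B m)) Xrho// -ge gm.
    by rewrite integral_indic// setIT.
  have mXB m : measurable (X m @^-1` B m).
    by rewrite -[X in measurable X]setTI; apply: measurable_funPT => //; case: (mB m).
  have -> : (\prod_m e m)%:E = P (\bigcap_(m in [set` [set: 'I_M]%SET]) (X m @^-1` B m)).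
    rewrite Xind; last by move=> m; case: (mB m).
    rewrite (eq_bigr (fun m => (e m)%:E)); last by move=> m _; exact: PB.
    rewrite prodEFin; congr (_%:E); apply: eq_bigl => m; by rewrite inE.
  rewrite -[in RHS](setIT (\bigcap_(_ in _) _)) -integral_indic//; last first.
    by apply: fin_bigcap_measurable => //; exact: finite_finset.
  apply: eq_integral => w _; congr (_%:E).
  have [wB|wB] := pselect ((\bigcap_(m in [set` [set: 'I_M]%SET]) (X m @^-1` B m)) w).
    rewrite indicE mem_set// big1// => m _.
    by have [_ ->] := mB m; rewrite indicE mem_set//; apply: wB; rewrite /= inE.
  rewrite indicE memNset//.
  have /existsNP[m /not_implyP[_ wBm]] := wB.
  by rewrite (bigD1 m)//=; have [_ ->] := mB m; rewrite indicE memNset// mul0r.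
pose i0 := Ordinal kM.
under eq_integral do rewrite (bigD1 i0)//= mulrC.
rewrite (ge0_integral_transfer (rho := rho) (c := \prod_(m < M | m != i0) e m))//.
- by rewrite ge -EFinM [in RHS](bigD1 i0)//= mulrC.
- under eq_fun do rewrite -big_filter.
  by apply: measurable_prod => m _; apply: measurableT_comp => //; exact: measurable_funPT.
- by move=> w _; apply: prodr_ge0.
- apply: prodr_ge0 => m _; rewrite -lee_fin -ge.
  by apply: integral_ge0 => x _; rewrite lee_fin.
move=> B mB.
pose g' m := if m == i0 then \1_B : T -> R else g m.
pose e' m := if m == i0 then fine (rho B) else e m.
have -> : ((\prod_(m < M | m != i0) e m)%:E * rho B)%E = (\prod_m e' m)%:E.
  rewrite [in RHS](bigD1 i0)//= {1}/e' eqxx mulrC EFinM fineK ?fin_num_measure//.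
  by congr (_%:E * _)%E; apply: eq_bigr => m mi0; rewrite /e' (negbTE mi0).
rewrite -(IH (ltnW kM) g' e').
- apply: eq_integral => w _; congr (_%:E).
  rewrite [RHS](bigD1 i0)//= [RHS]mulrC; congr (_ * _); last by rewrite /g' eqxx.
  by apply: eq_bigr => m mi0; rewrite /g' (negbTE mi0).
- by move=> m; rewrite /g'; case: ifP.
- by move=> m x; rewrite /g'; case: ifP.
- move=> m; rewrite /g' /e'; case: ifP => // _.
  by rewrite integral_indic// setIT fineK// fin_num_measure.
- move=> m km; rewrite /g'; case: ifPn => [_|mi0]; first by exists B.
  by apply: gB; rewrite ltn_neqAle km andbT; apply: contra mi0 => /eqP e0; apply/eqP/val_inj.
Qed.

(** * Exponential tails of empirical means *)

Section Bounded.
Context {R : realType} {d} {T : measurableType d} (rho : probability T R).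
Implicit Types f g : T -> R.

Definition bounded_measurable f :=
  measurable_fun setT f /\ exists b, forall x, `|f x| <= b.

Lemma bounded_measurable_cst c : bounded_measurable (fun _ => c).
Proof. by split => //; exists `|c|. Qed.

Lemma bounded_measurableD f g : bounded_measurable f -> bounded_measurable g ->
  bounded_measurable (fun x => f x + g x).
Proof.
move=> [mf [b fb]] [mg [c gc]]; split; first exact: measurable_funD.
by exists (b + c) => x; rewrite (le_trans (ler_normD _ _))// lerD.
Qed.

Lemma bounded_measurableM f g : bounded_measurable f -> bounded_measurable g ->
  bounded_measurable (fun x => f x * g x).
Proof.
move=> [mf [b fb]] [mg [c gc]]; split; first exact: measurable_funM.
by exists (b * c) => x; rewrite normrM ler_pM.
Qed.

Lemma bounded_measurableZ c f : bounded_measurable f ->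
  bounded_measurable (fun x => c * f x).
Proof. exact: bounded_measurableM (bounded_measurable_cst c). Qed.

Lemma bounded_measurableN f : bounded_measurable f ->
  bounded_measurable (fun x => - f x).
Proof. by move=> /(bounded_measurableZ (-1)); under eq_fun do rewrite mulN1r. Qed.

Lemma bounded_measurableB f g : bounded_measurable f -> bounded_measurable g ->
  bounded_measurable (fun x => f x - g x).
Proof. by move=> bf /bounded_measurableN; exact: bounded_measurableD. Qed.

Lemma bounded_measurable_sum (I : Type) (s : seq I) (f : I -> T -> R) :
  (forall i, bounded_measurable (f i)) ->
  bounded_measurable (fun x => \sum_(i <- s) f i x).
Proof.
move=> bf; elim: s => [|i s IH].
  by under eq_fun do rewrite big_nil; exact: bounded_measurable_cst.
by under eq_fun do rewrite big_cons; exact: bounded_measurableD.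
Qed.

Lemma bounded_measurable_integrable f : bounded_measurable f ->
  rho.-integrable setT (EFin \o f).
Proof.
move=> [mf [b fb]]; apply: measurable_bounded_integrable => //.
  by rewrite -ge0_fin_numE// fin_num_measure.
by exists b; split; [exact: num_real|move=> M bM x _; exact: le_trans (ltW bM)].
Qed.

Lemma meanD f g : bounded_measurable f -> bounded_measurable g ->
  \int[rho]_x (f x + g x) = \int[rho]_x f x + \int[rho]_x g x.
Proof. by move=> bf bg; rewrite RintegralD//; exact: bounded_measurable_integrable. Qed.

Lemma meanZ c f : bounded_measurable f ->
  \int[rho]_x (c * f x) = c * \int[rho]_x f x.
Proof. by move=> bf; rewrite RintegralZl//; exact: bounded_measurable_integrable. Qed.

Lemma mean_cst c : \int[rho]_x (cst c x) = c.
Proof.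
rewrite (Rintegral_cst rho measurableT).
rewrite -[RHS]mulr1; congr (_ * _).
exact: (congr1 fine (probability_setT rho)).
Qed.

Lemma mean_sum (I : Type) (s : seq I) (f : I -> T -> R) :
  (forall i, bounded_measurable (f i)) ->
  \int[rho]_x (\sum_(i <- s) f i x) = \sum_(i <- s) \int[rho]_x f i x.
Proof.
move=> bf; elim: s => [|i s IH].
  by rewrite big_nil; under eq_Rintegral do rewrite big_nil; exact: mean_cst.
rewrite big_cons -IH -meanD//; last exact: bounded_measurable_sum.
by apply: eq_Rintegral => x _; rewrite big_cons.
Qed.

Lemma le_mean f g : bounded_measurable f -> bounded_measurable g ->
  (forall x, f x <= g x) -> \int[rho]_x f x <= \int[rho]_x g x.
Proof. by move=> bf bg fg; apply: le_Rintegral => //; exact: bounded_measurable_integrable. Qed.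

Lemma EFin_mean f : bounded_measurable f ->
  (\int[rho]_x (f x)%:E = (\int[rho]_x f x)%:E)%E.
Proof.
move=> bf; rewrite /Rintegral fineK//.
exact: (integrable_fin_num measurableT (bounded_measurable_integrable bf)).
Qed.

Lemma normr_mean_le f b : measurable_fun setT f -> (forall x, `|f x| <= b) ->
  `|\int[rho]_x f x| <= b.
Proof.
move=> mf fb; have bf : bounded_measurable f by split => //; exists b.
rewrite ler_norml; apply/andP; split.
- rewrite -[leLHS]mean_cst; apply: le_mean => // [|x /=]; first exact: bounded_measurable_cst.
  by have := fb x; rewrite ler_norml => /andP[].
- rewrite -[leRHS]mean_cst; apply: le_mean => // [|x /=]; first exact: bounded_measurable_cst.
  by have := fb x; rewrite ler_norml => /andP[].
Qed.

End Bounded.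

(** Squaring [1 - y / 2 <= exp (- y / 2)] gives a bound with quadratic
    coefficient [3 / 4]; the margin up to [4 / 5] absorbs the cubic term. *)
Lemma expR_le_quadratic (R : realType) (y : R) : `|y| <= 12^-1 ->
  expR y <= 1 + y + 4 / 5 * y ^+ 2.
Proof.
rewrite ler_norml => /andP[y1 y2].
have h : 1 - y / 2 <= expR (- (y / 2)) by rewrite (le_trans _ (expR_ge1Dx _)).
have {}h : (1 - y / 2) ^+ 2 <= expR (- y).
  have -> : - y = - (y / 2) + - (y / 2) by lra.
  by rewrite expRD -expr2 ler_sqr ?nnegrE ?expR_ge0//; lra.
have : expR y * (1 - y / 2) ^+ 2 <= 1.
  by rewrite (le_trans (ler_wpM2l (expR_ge0 y) h))// -expRD subrr expR0.
have : 1 <= (1 + y + 4 / 5 * y ^+ 2) * (1 - y / 2) ^+ 2.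
  have : 0 <= y ^+ 2 * (1 / 20 - 11 / 20 * y + 1 / 5 * y ^+ 2).
    by rewrite mulr_ge0 ?sqr_ge0//; have := sqr_ge0 y; lra.
  by rewrite !expr2; lra.
have h0 : 0 < (1 - y / 2) ^+ 2 by rewrite exprn_gt0//; lra.
by move=> h1 h2; rewrite -(ler_pM2r h0) (le_trans h2).
Qed.

Lemma mean_expR_le (R : realType) d (T : measurableType d)
    (rho : probability T R) (f : T -> R) (b v l : R) :
  measurable_fun setT f -> (forall x, `|f x| <= b) ->
  \int[rho]_x (f x ^+ 2) <= v -> 0 <= l -> l * (2 * b) <= 12^-1 ->
  \int[rho]_x expR (l * (f x - \int[rho]_x f x)) <= expR (4 / 5 * l ^+ 2 * v).
Proof.
move=> mf fb fv l0 lb; set m := \int[rho]_x f x.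
have bf : bounded_measurable f by split => //; exists b.
have mb : `|m| <= b by exact: normr_mean_le.
have yb x : `|l * (f x - m)| <= 12^-1.
  rewrite normrM ger0_norm// (le_trans _ lb)// ler_wpM2l//.
  by rewrite (le_trans (ler_normB _ _))// mulr2n mulrDl mul1r lerD.
have bfm : bounded_measurable (fun x => f x - m).
  exact: bounded_measurableB (bounded_measurable_cst _).
have bf2 : bounded_measurable (fun x => f x ^+ 2) by exact: bounded_measurableM.
have b1 : bounded_measurable (fun x => 1 + l * (f x - m) : R).
  by apply: bounded_measurableD; [exact: bounded_measurable_cst|exact: bounded_measurableZ].
have b2 : bounded_measurable (fun x => 4 / 5 * l ^+ 2 * (f x - m) ^+ 2).
  by apply: bounded_measurableZ; exact: bounded_measurableM.
apply: (@le_trans _ _ (\int[rho]_x (1 + l * (f x - m) + 4 / 5 * l ^+ 2 * (f x - m) ^+ 2))).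
  apply: le_mean.
  - split.
      by apply: measurableT_comp => //; apply: measurable_funM => //; exact: measurable_funB.
    exists (expR 12^-1) => x; rewrite ger0_norm ?expR_ge0// ler_expR.
    by have := yb x; rewrite ler_norml => /andP[].
  - exact: bounded_measurableD.
  - move=> x; rewrite (le_trans (expR_le_quadratic (yb x)))//.
    by rewrite exprMn mulrA.
rewrite (le_trans _ (expR_ge1Dx _))//.
rewrite meanD// meanD//; [|exact: bounded_measurable_cst|exact: bounded_measurableZ].
rewrite mean_cst meanZ// meanZ//; last exact: bounded_measurableM.
have -> : \int[rho]_x (f x - m) = 0.
  rewrite (@meanD _ _ _ _ f (fun=> - m))//; last exact: bounded_measurable_cst.
  by rewrite mean_cst subrr.
rewrite mulr0 addr0 lerD2l ler_wpM2l//; first by rewrite mulr_ge0// sqr_ge0.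
have -> : \int[rho]_x ((f x - m) ^+ 2) = \int[rho]_x (f x ^+ 2 + (- (2 * m) * f x + m ^+ 2)).
  by apply: eq_Rintegral => x _; rewrite !expr2; ring.
rewrite meanD//; last first.
  apply: bounded_measurableD; last exact: bounded_measurable_cst.
  exact: bounded_measurableZ.
rewrite meanD//; [|exact: bounded_measurableZ|exact: bounded_measurable_cst].
rewrite meanZ// mean_cst -/m (le_trans _ fv)// gerDl.
rewrite -[leLHS]/(- (2 * m) * m + m ^+ 2).
by rewrite (_ : _ + _ = - m ^+ 2) ?oppr_le0 ?sqr_ge0//; ring.
Qed.

Lemma measure_bigsetU_le (R : realType) d (T : measurableType d)
    (mu : {measure set T -> \bar R}) (I : Type) (s : seq I) (B : I -> set T) :
  (forall i, measurable (B i)) ->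
  (mu (\big[setU/set0]_(i <- s) B i) <= \sum_(i <- s) mu (B i))%E.
Proof.
move=> mB; elim: s => [|i s IH]; first by rewrite !big_nil measure0.
rewrite !big_cons (le_trans (measureU2 _ _ _))//; first exact: bigsetU_measurable.
exact: leeD2l.
Qed.

(** Bernstein's inequality in the regime where the deviation [t] is small
    compared with the ratio [v / b] of variance to bound; the optimal exponent
    would be [1 / 2] instead of [5 / 16]. *)
Lemma upper_tail_le (R : realType) d d' (T : measurableType d)
    (Omega : measurableType d') (P : probability Omega R)
    (rho : probability T R) (M : nat) (X : 'I_M -> {RV P >-> T})
    (f : T -> R) (b v t : R) :
  independent_samples rho X ->
  measurable_fun setT f -> (forall x, `|f x| <= b) ->
  \int[rho]_x (f x ^+ 2) <= v -> 0 < t -> 0 < v -> 15 * t * b <= v ->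
  (P [set w | M%:R * t <= \sum_m (f (X m w) - \int[rho]_x f x)]%R
    <= (expR (- (5 / 16 * (M%:R * t ^+ 2 / v))))%:E)%E.
Proof.
move=> ind mf fb fv t0 v0 tb; set m := \int[rho]_x f x.
(* minimizes [- l * t + 4 / 5 * l ^+ 2 * v] *)
pose l := 5 / 8 * (t / v).
have l0 : 0 < l by rewrite mulr_gt0// divr_gt0.
have lb : l * (2 * b) <= 12^-1.
  have -> : l * (2 * b) = (15 * t * b) / v / 12 by rewrite /l; field; rewrite gt_eqF.
  by rewrite -[leRHS]mul1r ler_wpM2r// ler_pdivrMr// mul1r.
pose g x := expR (l * (f x - m)).
have mg : measurable_fun setT g.
  by apply: measurableT_comp => //; apply: measurable_funM => //; exact: measurable_funB.
have g0 x : 0 <= g x by exact: expR_ge0.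
have bg : bounded_measurable g.
  split=> //; exists (expR 12^-1) => x; rewrite ger0_norm// ler_expR.
  have mb : `|m| <= b by exact: normr_mean_le.
  rewrite (le_trans _ lb)// ler_pM2l//.
  rewrite (le_trans (ler_norm _))// (le_trans (ler_normB _ _))//.
  by rewrite mulr2n mulrDl mul1r lerD.
set S := [set w | _].
have mS : measurable S.
  rewrite -[S]setTI; apply: measurable_fun_le => //.
  apply: measurable_sum => i; apply: measurable_funB => //.
  by apply: measurableT_comp => //; exact: measurable_funPT.
have mprod : measurable_fun setT (fun w => \prod_i g (X i w)).
  by apply: measurable_prod => i _; apply: measurableT_comp => //; exact: measurable_funPT.
rewrite -[S]setIT -integral_indic//.
apply: (@le_trans _ _ (\int[P]_w (expR (- (l * (M%:R * t))) * \prod_i g (X i w))%:E)%E).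
  apply: ge0_le_integral => //.
  - by apply/measurable_EFinP/measurable_indic.
  - by apply/measurable_EFinP/measurable_funM.
  - move=> w _; rewrite lee_fin indicE.
    case wS : (w \in S); last by rewrite mulr_ge0 ?expR_ge0// prodr_ge0.
    rewrite -expR_sum -expRD -[leLHS]expR0 ler_expR -mulr_sumr addrC -mulrBr.
    by rewrite mulr_ge0 ?(ltW l0)// subr_ge0; exact: set_mem wS.
under eq_integral do rewrite EFinM.
rewrite ge0_integralZl//; last 2 first.
- exact/measurable_EFinP.
- by move=> w _; rewrite lee_fin prodr_ge0.
rewrite (expectation_prod_independent (rho := rho) (g := fun=> g)
  (e := fun=> \int[rho]_x g x))//; last by move=> i; exact: EFin_mean.
rewrite -EFinM lee_fin prodr_const card_ord.
have Eg : \int[rho]_x g x <= expR (4 / 5 * l ^+ 2 * v).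
  by apply: mean_expR_le => //; exact: ltW.
apply: (@le_trans _ _ (expR (- (l * (M%:R * t))) * expR (4 / 5 * l ^+ 2 * v) ^+ M)).
  rewrite ler_pM2l ?expR_gt0// lerXn2r ?nnegrE ?expR_ge0//.
  by apply: Rintegral_ge0 => x _.
rewrite -expRM_natl -expRD ler_expR le_eqVlt; apply/orP; left; apply/eqP.
by rewrite /l; field; rewrite gt_eqF.
Qed.

(** Each observable has its own threshold, so that the thresholds can be chosen
    to give all of them the same bound [r] on the failure probability. *)
Lemma family_tail_le (R : realType) d d' (T : measurableType d)
    (Omega : measurableType d') (P : probability Omega R)
    (rho : probability T R) (M : nat) (X : 'I_M -> {RV P >-> T})
    (I : finType) (f : I -> T -> R) (b : R) (v t : I -> R) (r : R) :
  independent_samples rho X ->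
  (forall i, measurable_fun setT (f i)) -> (forall i x, `|f i x| <= b) ->
  (forall i, \int[rho]_x (f i x ^+ 2) <= v i) ->
  (forall i, 0 < t i) -> (forall i, 0 < v i) -> (forall i, 15 * t i * b <= v i) ->
  (forall i, expR (- (5 / 16 * (M%:R * t i ^+ 2 / v i))) <= r) ->
  exists A : set Omega, [/\ measurable A,
    (P A <= (2 * #|I|%:R * r)%:E)%E
    & forall w, ~ A w -> forall i,
        `|\sum_m (f i (X m w) - \int[rho]_x f i x)| <= M%:R * t i].
Proof.
move=> ind mf fb fv t0 v0 tb er.
pose h (i : I) (s : bool) x := (-1) ^+ s * f i x.
have mh i s : measurable_fun setT (h i s) by exact: measurable_funM.
pose B (j : I * bool) := [set w | M%:R * t j.1 <=
  \sum_m (h j.1 j.2 (X m w) - \int[rho]_x h j.1 j.2 x)%R].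
have mB j : measurable (B j).
  rewrite -[B j]setTI; apply: measurable_fun_le => //.
  apply: measurable_sum => i; apply: measurable_funB => //.
  by apply: measurableT_comp => //; exact: measurable_funPT.
have PB j : (P (B j) <= r%:E)%E.
  apply: (@le_trans _ _ (expR (- (5 / 16 * (M%:R * t j.1 ^+ 2 / v j.1))))%:E); last first.
    by rewrite lee_fin.
  apply: (@upper_tail_le _ _ _ _ _ _ rho M X (h j.1 j.2) b) => //.
    by move=> x; rewrite normrM normr_sign mul1r.
  by under eq_Rintegral do rewrite exprMn sqrr_sign mul1r.
exists (\big[setU/set0]_j B j); split.
- exact: bigsetU_measurable.
- apply: (@le_trans _ _ (\sum_j P (B j))%E).
    exact: measure_bigsetU_le.
  apply: (@le_trans _ _ (\sum_(j : I * bool) r%:E)%E); first exact: lee_sum.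
  rewrite sumEFin sumr_const card_prod card_bool lee_fin -[leLHS]mulr_natl natrM.
  by rewrite (mulrC #|I|%:R).
move=> w nBw i.
have nB s : \sum_m (h i s (X m w) - \int[rho]_x h i s x) <= M%:R * t i.
  rewrite leNgt; apply/negP => /ltW wB; apply: nBw.
  by rewrite (bigD1 (i, s))//=; left.
have := nB false; have := nB true.
have hf x : h i false x = f i x by rewrite /h mul1r.
have hm : \int[rho]_x h i false x = \int[rho]_x f i x by exact: eq_Rintegral.
have hmN : \int[rho]_x h i true x = - \int[rho]_x f i x.
  by rewrite meanZ ?expr1 ?mulN1r//; split => //; exists b.
rewrite hm hmN => h1 h2; rewrite ler_norml; apply/andP; split; last first.
  by move: h2; under eq_bigr do rewrite hf.
rewrite lerNl -sumrN (le_trans _ h1)// le_eqVlt; apply/orP; left; apply/eqP.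
by apply: eq_bigr => m _; rewrite /h expr1 mulN1r opprB opprK addrC.
Qed.

(** * Complex-valued observables *)

Section ComplexParts.
Context {R : realType}.
Implicit Types z : R[i].

(** Indexing the real ([false]) and imaginary ([true]) parts by a boolean lets
    both enter one finite family of real observables. *)
Definition part (s : bool) z : R := if s then complex.Im z else complex.Re z.

Lemma partD s z1 z2 : part s (z1 + z2) = part s z1 + part s z2.
Proof. by case: z1 => ? ?; case: z2 => ? ?; case: s. Qed.

Lemma part0 s : part s 0 = 0. Proof. by case: s. Qed.

Lemma part_sum s (I : Type) (r : seq I) (Q : pred I) (f : I -> R[i]) :
  part s (\sum_(i <- r | Q i) f i) = \sum_(i <- r | Q i) part s (f i).
Proof. by apply: (big_morph (part s)) => [? ?|]; [exact: partD|exact: part0]. Qed.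

Lemma partZ s (c : R) z : part s (c%:C * z) = c * part s z.
Proof. by case: z => ? ?; case: s => /=; ring. Qed.

Lemma part_mul s z1 z2 :
  part s (z1 * z2) = part s z1 * complex.Re z2 +
    (if s then 1 else -1) * part (~~ s) z1 * complex.Im z2.
Proof. by case: z1 => ? ?; case: z2 => ? ?; case: s => /=; ring. Qed.

Lemma eq_parts z1 z2 : (forall s, part s z1 = part s z2) -> z1 = z2.
Proof. by move: z1 z2 => [a b] [a' b'] h; congr (_ +i* _); [exact: (h false)|exact: (h true)]. Qed.

Lemma normc_sqE z : normc z ^+ 2 = complex.Re z ^+ 2 + complex.Im z ^+ 2.
Proof. by case: z => x y /=; rewrite sqr_sqrtr// addr_ge0 ?sqr_ge0. Qed.

Lemma normc_sq_parts z : normc z ^+ 2 = \sum_s part s z ^+ 2.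
Proof. by rewrite normc_sqE big_bool /= addrC. Qed.

Lemma normc_ge0 z : 0 <= normc z.
Proof. by case: z => x y; exact: sqrtr_ge0. Qed.

Lemma part_le s z : `|part s z| <= normc z.
Proof.
rewrite -ler_sqr ?nnegrE ?normc_ge0// real_normK ?num_real// normc_sq_parts.
by rewrite (bigD1 s)//= lerDl sumr_ge0// => ? _; exact: sqr_ge0.
Qed.

Lemma conjc_mul z : z * conjc z = (normc z ^+ 2)%:C.
Proof.
rewrite normc_sqE; case: z => x y; apply/eqP; rewrite eq_complex /=.
by apply/andP; split; apply/eqP; ring.
Qed.

Lemma normc_conj (z : R[i]) : normc (conjc z) = normc z.
Proof. by case: z => a b /=; rewrite sqrrN. Qed.

Lemma normc_real (r : R) : 0 <= r -> normc r%:C = r.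
Proof. by move=> r0; rewrite /= expr0n/= addr0 sqrtr_sqr ger0_norm. Qed.

Lemma part_sq_le s z : part s z ^+ 2 <= normc z ^+ 2.
Proof.
rewrite -[leLHS]real_normK ?num_real// ler_sqr ?nnegrE ?normc_ge0//.
exact: part_le.
Qed.

Lemma normc_opp z : normc (- z) = normc z.
Proof. exact: normcN. Qed.

Lemma normc_add_le z1 z2 : normc (z1 + z2) <= normc z1 + normc z2.
Proof. exact: le_normcD. Qed.

Lemma normc_sum (I : Type) (r : seq I) (Q : pred I) (f : I -> R[i]) :
  normc (\sum_(i <- r | Q i) f i) <= \sum_(i <- r | Q i) normc (f i).
Proof.
elim/big_ind2 : _ => //; first by rewrite normc0.
by move=> ? ? ? ? h1 h2; rewrite (le_trans (normc_add_le _ _))// lerD.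
Qed.

End ComplexParts.

Lemma cauchy_schwarz_sum (R : realType) (I : finType) (a b : I -> R) :
  (\sum_i a i * b i) ^+ 2 <= (\sum_i a i ^+ 2) * (\sum_i b i ^+ 2).
Proof.
have : 0 <= \sum_i \sum_j (a i * b j - a j * b i) ^+ 2.
  by apply: sumr_ge0 => i _; apply: sumr_ge0 => j _; exact: sqr_ge0.
have -> : \sum_i \sum_j (a i * b j - a j * b i) ^+ 2 =
  \sum_i \sum_j a i ^+ 2 * b j ^+ 2 + \sum_i \sum_j a j ^+ 2 * b i ^+ 2
  - 2 * \sum_i \sum_j (a i * b i) * (a j * b j).
  rewrite mulr_sumr -sumrN -!big_split /=; apply: eq_bigr => i _.
  rewrite mulr_sumr -sumrN -!big_split /=; apply: eq_bigr => j _.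
  by rewrite !expr2; ring.
rewrite [X in _ + X - _]exchange_big /=.
rewrite expr2 !big_distrlr /=; lra.
Qed.

Section GramPerturbation.
Context {R : realType} {N : nat}.
Implicit Types (v a : 'rV[R[i]]_N) (A : 'M[R[i]]_N).

(** Squared Frobenius norm; squares are used throughout because the error
    budgets of the coordinates add. *)
Definition nsq m n (B : 'M[R[i]]_(m, n)) : R := \sum_i \sum_j normc (B i j) ^+ 2.

Lemma nsq_ge0 m n (B : 'M[R[i]]_(m, n)) : 0 <= nsq B.
Proof. by apply: sumr_ge0 => i _; apply: sumr_ge0 => j _; exact: sqr_ge0. Qed.

Lemma nsq_row v : nsq v = \sum_j normc (v 0 j) ^+ 2.
Proof. by rewrite /nsq big_ord1. Qed.

Lemma nsq_row_eq0 v : nsq v = 0 -> v = 0.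
Proof.
rewrite nsq_row => /eqP; rewrite psumr_eq0 => [/allP h|j _]; last exact: sqr_ge0.
apply/rowP => j; rewrite mxE; apply: eq0_normc; apply/eqP.
by have := h j; rewrite mem_index_enum sqrf_eq0; exact.
Qed.

Lemma nsq_mulmx_le v A : nsq (v *m A) <= nsq v * nsq A.
Proof.
rewrite !nsq_row [X in _ <= _ * X]exchange_big /= mulr_sumr.
apply: ler_sum => j _; apply: le_trans (cauchy_schwarz_sum _ _).
rewrite ler_sqr ?nnegrE ?normc_ge0 ?sumr_ge0// => [|i _]; last by rewrite mulr_ge0 ?normc_ge0.
by rewrite mxE (le_trans (normc_sum _ _ _))// ler_sum// => i _; rewrite normcM.
Qed.

(** The constants fit exactly: with [y = a A^-1 - a],
    [|y|^2 <= (20/19) |a A - a|^2 + 20 |y (A - 1)|^2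
    <= (19/20) e + (1/20) |y|^2]. *)
Lemma invmx_gram_close A a (e : R) :
  nsq (A - 1%:M) <= 400^-1 ->
  nsq (a *m A - a) <= 361 / 400 * e ->
  A \in unitmx /\ nsq (a *m invmx A - a) <= e.
Proof.
move=> hA ha.
have uA : A \in unitmx.
  rewrite -row_free_unit; apply: inj_row_free => v vA0.
  apply: nsq_row_eq0; apply/eqP; rewrite eq_le nsq_ge0 andbT.
  have := nsq_mulmx_le v (A - 1%:M); rewrite mulmxBr mulmx1 vA0 sub0r.
  have -> : nsq (- v) = nsq v.
    by rewrite !nsq_row; apply: eq_bigr => j _; rewrite mxE normc_opp.
  have := nsq_ge0 v; nra.
split=> //; set y := a *m invmx A - a.
have ey : y = - (a *m A - a) - y *m (A - 1%:M).
  have yA : y *m A = a - a *m A by rewrite mulmxBl mulmxKV.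
  by rewrite mulmxBr mulmx1 yA opprB opprB addrC subrK.
have := nsq_mulmx_le y (A - 1%:M).
set Y := nsq (y *m _) => hY.
have h : nsq y <= 20 / 19 * nsq (a *m A - a) + 20 * Y.
  rewrite {1}ey /Y !nsq_row !mulr_sumr -big_split /=; apply: ler_sum => j _.
  have -> : (- (a *m A - a) - y *m (A - 1%:M)) 0 j =
      - ((a *m A - a) 0 j + (y *m (A - 1%:M)) 0 j).
    by rewrite -opprD mxE; congr (- _); rewrite mxE.
  rewrite normc_opp.
  set p := (a *m A - a) 0 j; set q := (y *m _) 0 j.
  have := normc_add_le p q; have := normc_ge0 (p + q).
  have := sqr_ge0 (normc p - 19 * normc q).
  move: (normc _) (normc _) (normc _) => np nq npq.
  nra.
have := nsq_ge0 y; nra.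
Qed.

End GramPerturbation.

Section ComplexMean.
Context {R : realType} {d} {T : measurableType d} (rho : probability T R).
Implicit Types u : T -> R[i].

Definition cbounded u := forall s, bounded_measurable (fun x => part s (u x)).

Lemma cboundedZ c u : cbounded u -> cbounded (fun x => c * u x).
Proof.
move=> bu s; under eq_fun do rewrite part_mul.
by apply: bounded_measurableD; apply: bounded_measurableZ; [exact: (bu false)|exact: (bu true)].
Qed.

Lemma cbounded_sum (I : Type) (r : seq I) (u : I -> T -> R[i]) :
  (forall i, cbounded (u i)) -> cbounded (fun x => \sum_(i <- r) u i x).
Proof.
move=> bu s; under eq_fun do rewrite part_sum.
by apply: bounded_measurable_sum => i; exact: bu.
Qed.

Lemma part_cintegral s u :
  part s (cintegral rho setT u) = \int[rho]_x part s (u x).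
Proof. by case: s. Qed.

Lemma cmeanZ c u : cbounded u ->
  cintegral rho setT (fun x => c * u x) = c * cintegral rho setT u.
Proof.
move=> bu; apply: eq_parts => s; rewrite part_cintegral part_mul.
under eq_Rintegral do rewrite part_mul.
rewrite meanD; [|exact/bounded_measurableZ/(bu false)|exact/bounded_measurableZ/(bu true)].
by rewrite meanZ ?meanZ//; [exact: (bu true)|exact: (bu false)].
Qed.

Lemma cmean_sum (I : Type) (r : seq I) (u : I -> T -> R[i]) :
  (forall i, cbounded (u i)) ->
  cintegral rho setT (fun x => \sum_(i <- r) u i x) = \sum_(i <- r) cintegral rho setT (u i).
Proof.
move=> bu; apply: eq_parts => s; rewrite part_cintegral part_sum.
under eq_Rintegral do rewrite part_sum.
by rewrite mean_sum => [|i]; [apply: eq_bigr => i _; rewrite part_cintegral|exact: bu].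
Qed.

End ComplexMean.

(** The threshold of the coordinate [(i, s)] is [sqrt (k * v i s)],
    proportional to the standard deviation when [v i s] is the variance: the
    common exponent depends on [k] alone, and the total squared error is [k]
    times the total variance. *)
Lemma complex_family_tail_le (R : realType) d d' (T : measurableType d)
    (Omega : measurableType d') (P : probability Omega R)
    (rho : probability T R) (M : nat) (X : 'I_M -> {RV P >-> T})
    (I : finType) (u : I -> T -> R[i]) (b k r : R) (v : I -> bool -> R) :
  (0 < M)%N -> independent_samples rho X ->
  (forall i, cbounded (u i)) -> (forall i x, normc (u i x) <= b) ->
  (forall i s, \int[rho]_x (part s (u i x) ^+ 2) <= v i s) ->
  0 < k -> (forall i s, 0 < v i s) ->
  (forall i s, (15 * b) ^+ 2 * k <= v i s) ->
  expR (- (5 / 16 * (M%:R * k))) <= r ->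
  exists A : set Omega, [/\ measurable A,
    (P A <= (4 * #|I|%:R * r)%:E)%E
    & forall w, ~ A w ->
        \sum_i normc (M%:R^-1 * (\sum_m u i (X m w)) - cintegral rho setT (u i)) ^+ 2
        <= k * \sum_i \sum_s v i s].
Proof.
move=> M0 ind bu ub uv k0 v0 kv er.
pose t (j : I * bool) := Num.sqrt (k * v j.1 j.2).
have t2 j : t j ^+ 2 = k * v j.1 j.2 by rewrite sqr_sqrtr// mulr_ge0 ?ltW.
have t0 j : 0 < t j by rewrite sqrtr_gt0 mulr_gt0.
have tb j : 15 * t j * b <= v j.1 j.2.
  rewrite (le_trans (ler_norm _))// -ler_sqr ?nnegrE ?(ltW (v0 _ _))//.
  rewrite real_normK ?num_real// mulrAC exprMn t2 mulrA expr2.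
  by rewrite ler_wpM2r ?kv// ltW.
have et j : expR (- (5 / 16 * (M%:R * t j ^+ 2 / v j.1 j.2))) <= r.
  by rewrite t2 (mulrA M%:R) mulfK ?gt_eqF.
have [A [mA PA hA]] := @family_tail_le R d d' T Omega P rho M X (I * bool)%type
  (fun j x => part j.2 (u j.1 x)) b (fun j => v j.1 j.2) t r ind
  (fun j => (bu j.1 j.2).1) (fun j x => le_trans (part_le _ _) (ub j.1 x))
  (fun j => uv j.1 j.2) t0 (fun j => v0 j.1 j.2) tb et.
exists A; split=> //.
  apply: le_trans PA _; rewrite lee_fin card_prod card_bool natrM.
  by rewrite le_eqVlt; apply/orP; left; apply/eqP; ring.
move=> w /hA {}hA.
rewrite [leRHS]mulr_sumr; apply: ler_sum => i _.
rewrite normc_sq_parts [leRHS]mulr_sumr; apply: ler_sum => s _.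
rewrite -(t2 (i, s)) -[leLHS]real_normK ?num_real// ler_sqr ?nnegrE ?(ltW (t0 _))//.
have -> : part s (M%:R^-1 * (\sum_m u i (X m w)) - cintegral rho setT (u i)) =
    M%:R^-1 * \sum_m (part s (u i (X m w)) - \int[rho]_x part s (u i x)).
  have -> : (M%:R^-1 : R[i]) = (M%:R^-1)%:C by rewrite fmorphV rmorph_nat.
  rewrite partD partZ part_sum -mulN1r -(rmorphN1 (real_complex R)) partZ mulN1r.
  rewrite part_cintegral sumrB sumr_const card_ord.
  rewrite -[(Rintegral _ _ _) *+ M]mulr_natl mulrBr mulKf//.
  by rewrite pnatr_eq0 -lt0n.
have M0' : 0 < M%:R :> R by rewrite ltr0n.
rewrite normrM ger0_norm ?invr_ge0 ?ler0n// mulrC ler_pdivrMr// mulrC.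
exact: (hA (i, s)).
Qed.

(** * Concentration of the inverse Gram matrix on one vector *)

(** The union bound over the [2 N] two-sided coordinates costs a factor [4 N],
    which one power of [xi / (4 N)] pays for; the remaining half power is at
    most [1 / 2] since [4 * n / xi >= 4]. *)
Lemma failure_budget (R : realType) (n xi : R) : 1 <= n -> 0 < xi -> xi < 1 ->
  4 * n * expR (- (3 / 2 * ln (4 * n / xi))) <= xi / 2.
Proof.
move=> n1 xi0 xi1; set y := 4 * n / xi.
have y4 : 4 <= y by rewrite /y ler_pdivlMr//; nra.
have y0 : 0 < y by lra.
pose z := expR (- (ln y / 2)).
have zz : z * z = y^-1.
  by rewrite -expRD -opprD -splitr expRN lnK// posrE.
have z0 : 0 < z by exact: expR_gt0.
have z2 : z <= 1 / 2.
  have : y^-1 <= 4^-1 by rewrite lef_pV2 ?posrE//; lra.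
  rewrite -zz; nra.
have -> : - (3 / 2 * ln y) = - (ln y / 2) + - (ln y / 2) + - (ln y / 2) by lra.
rewrite !expRD -/z zz.
have -> : 4 * n = y * xi by rewrite /y divfK// gt_eqF.
have -> : y * xi * (y^-1 * z) = xi * z by field; rewrite gt_eqF.
by nra.
Qed.

Section Concentration.
Context {R : realType} {d} {T : measurableType d} (rho : probability T R).
Context {N : nat} (g : 'I_N -> 'I_N -> T -> R[i]) (Q : R).

Definition empirical_gram M (x : 'I_M -> T) : 'M[R[i]]_N :=
  \matrix_(i, j) (M%:R^-1 * \sum_m g i j (x m)).

(** Here [g i j] stands for the entries of the one-sample Gram matrix.  The
    pointwise inequality compares [|a g|^2] with [Q] times the Hermitian form of
    [g] at [a]; as [g] has mean [1], it bounds the second moment of [a g] by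
    [Q |a|^2]. *)
Lemma gram_inverse_concentration (a : 'rV[R[i]]_N) (sigma xi : R) :
  (0 < N)%N -> 0 < Q ->
  (forall i j, cbounded (g i j)) -> (forall i j x, normc (g i j x) <= Q) ->
  (forall i j, cintegral rho setT (g i j) = (i == j)%:R) ->
  (forall x, \sum_j normc (\sum_i a 0 i * g i j x) ^+ 2 <=
     Q * complex.Re (\sum_i a 0 i * (\sum_j conjc (a 0 j) * g i j x))) ->
  a != 0 -> 0 < sigma -> 0 < xi -> xi < 1 ->
  \forall J \near +oo, forall M,
    6 * Q * J / sigma ^+ 2 * ln (4 * N%:R / xi) <= M%:R ->
    forall d' (Omega : measurableType d') (P : probability Omega R)
      (X : 'I_M -> {RV P >-> T}),
    independent_samples rho X ->
    exists A : set Omega, [/\ measurable A, (P A <= (3 / 4 * xi)%:E)%E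
      & forall w, ~ A w -> let G := empirical_gram (fun m => X m w) in
          G \in unitmx /\
          nsq (a *m invmx G - a) <= sigma ^+ 2 / J * nsq a].
Proof.
move=> N0 Q0 bg gQ meang sqg a0 sigma0 xi0 xi1.
have n0 : 0 < nsq a.
  by rewrite lt_neqAle nsq_ge0 andbT eq_sym; apply: contra_neq a0; exact: nsq_row_eq0.
set n := nsq a.
have N1 : 1 <= N%:R :> R by rewrite ler1n.
set Lg := ln _.
have Lg0 : 0 < Lg.
  rewrite ln_gt0// ltr_pdivlMr//; nra.
have s20 : 0 < sigma ^+ 2 by rewrite exprn_gt0.
(* for the entries of [G - 1]: any [k1] independent of [J] with
   [k1 * (2 * N ^+ 2 * v1) <= 1 / 400] *)
pose v1 := (15 * Q) ^+ 2 + 1.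
have v11 : 1 <= v1 by rewrite lerDr sqr_ge0.
pose k1 := (800 * N%:R ^+ 2 * v1)^-1.
have k1d : 1 <= 800 * N%:R ^+ 2 * v1 by rewrite expr2; nra.
have k1d0 := lt_le_trans ltr01 k1d.
have k10 : 0 < k1 by rewrite invr_gt0; exact: k1d0.
have k11 : k1 <= 1 by rewrite (invf_le1 k1d0); exact: k1d.
pose r1 := xi / (16 * N%:R ^+ 2).
have r10 : 0 < r1 by rewrite divr_gt0// mulr_gt0// exprn_gt0//; lra.
(* for [a *m G]: a small fixed variance [s0] is added to each coordinate, so
   that the Bernstein regime is reached also where the variance vanishes *)
pose Y j x := \sum_i a 0 i * g i j x.
have bY j : cbounded (Y j) by apply: cbounded_sum => i; exact: cboundedZ.
have mY j : cintegral rho setT (Y j) = a 0 j.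
  rewrite cmean_sum => [|i]; last exact: cboundedZ.
  rewrite (bigD1 j)//= cmeanZ// meang eqxx mulr1 big1 ?addr0// => i ij.
  by rewrite cmeanZ// meang (negbTE ij) mulr0.
pose B := \sum_i normc (a 0 i) * Q.
have YB j x : normc (Y j x) <= B.
  rewrite (le_trans (normc_sum _ _ _))// ler_sum// => i _.
  by rewrite normcM ler_wpM2l ?normc_ge0.
pose s0 := Q * n / (20 * N%:R).
have s00 : 0 < s0 by rewrite divr_gt0 ?mulr_gt0//; lra.
pose v2 j s := \int[rho]_x (part s (Y j x) ^+ 2) + s0.
have v2s j s : s0 <= v2 j s by rewrite lerDr Rintegral_ge0// => x _; exact: sqr_ge0.
have part2 j s : bounded_measurable (fun x => part s (Y j x) ^+ 2).
  by apply: bounded_measurableM; exact: bY.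
have sumv2 : \sum_j \sum_s v2 j s <= 11 / 10 * (Q * n).
  pose S x := \sum_i a 0 i * (\sum_j conjc (a 0 j) * g i j x).
  have bS' i : cbounded (fun x => \sum_j conjc (a 0 j) * g i j x).
    by apply: cbounded_sum => j; exact: cboundedZ.
  have bS : cbounded S by apply: cbounded_sum => i; exact: cboundedZ.
  have mS : \int[rho]_x (complex.Re (S x)) = n.
    rewrite -[LHS](part_cintegral rho false S) cmean_sum => [|i]; last exact: cboundedZ.
    rewrite part_sum /n nsq_row; apply: eq_bigr => i _.
    rewrite cmeanZ// cmean_sum => [|j]; last exact: cboundedZ.
    rewrite (bigD1 i)//= cmeanZ// meang eqxx mulr1 big1 ?addr0 => [|j ji].
      by rewrite conjc_mul.
    by rewrite cmeanZ// meang eq_sym (negbTE ji) mulr0.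
  have h : \sum_j \sum_s \int[rho]_x (part s (Y j x) ^+ 2) <= Q * n.
    rewrite -mS -(meanZ rho _ (bS false)).
    under eq_bigr => j _ do rewrite -(mean_sum rho _ (part2 j)).
    rewrite -mean_sum => [|j]; last exact: bounded_measurable_sum.
    apply: le_mean => [||x].
    - by apply: bounded_measurable_sum => j; exact: bounded_measurable_sum.
    - exact: bounded_measurableZ (bS false).
    - by rewrite (le_trans _ (sqg x))// ler_sum// => j _; rewrite normc_sq_parts.
  have -> : \sum_j \sum_s v2 j s =
      \sum_j \sum_s \int[rho]_x (part s (Y j x) ^+ 2) + 1 / 10 * (Q * n).
    under eq_bigr do rewrite big_split /= sumr_const card_bool.
    rewrite big_split /= sumr_const card_ord; congr (_ + _).
    by rewrite -[LHS]mulr_natl -[s0 *+ 2]mulr_natl /s0; field; rewrite gt_eqF//; lra.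
  lra.
pose kappa := 361 / 440 * (sigma ^+ 2 / Q).
have kappa0 : 0 < kappa.
  have sQ : 0 < sigma ^+ 2 / Q by rewrite divr_gt0.
  rewrite /kappa; lra.
near=> J.
have J0 : 0 < J by near: J; exact: nbhs_pinfty_gt.
move=> M; rewrite -/Lg => hM d' Omega P X ind.
have M0' : 0 < M%:R :> R.
  by rewrite (lt_le_trans _ hM)// mulr_gt0// divr_gt0// mulr_gt0// mulr_gt0.
have M0 : (0 < M)%N by rewrite -(ltr0n R).
(* the failure probability of each entry is at most [r1] once [M], which is at
   least a multiple of [J], is large *)
have [A1 [mA1 PA1 hA1]] : exists A : set Omega, [/\ measurable A,
    (P A <= (4 * #|{: 'I_N * 'I_N}|%:R * r1)%:E)%E
    & forall w, ~ A w -> \sum_(i : 'I_N * 'I_N) normc (M%:R^-1 * (\sum_m g i.1 i.2 (X m w))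
         - cintegral rho setT (g i.1 i.2)) ^+ 2 <= k1 * \sum_(i : 'I_N * 'I_N) \sum_(s : bool) v1].
  apply: (@complex_family_tail_le _ _ _ _ _ _ rho M X _ (fun i => g i.1 i.2) Q) => //.
  - move=> i s; apply: (@le_trans _ _ (Q ^+ 2)); last by rewrite /v1 expr2; nra.
    rewrite -[leRHS](mean_cst rho); apply: le_mean => [||x /=].
    + by apply: bounded_measurableM; exact: bg.
    + exact: bounded_measurable_cst.
    + by rewrite (le_trans (part_sq_le _ _))// ler_sqr ?nnegrE ?normc_ge0// ltW.
  - by move=> _ _; lra.
  - by move=> _ _; rewrite /v1; have := sqr_ge0 (15 * Q); nra.
  - rewrite -[leRHS]lnK ?posrE// ler_expR lerNl.
    rewrite -ler_pdivrMl// -ler_pdivrMr// (le_trans _ hM)//.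
    rewrite [leRHS](_ : _ = (6 * Q / sigma ^+ 2 * Lg) * J); last by ring.
    rewrite -ler_pdivrMl; last by rewrite mulr_gt0// divr_gt0// mulr_gt0.
    by near: J; apply: nbhs_pinfty_ge; exact: num_real.
have [A2 [mA2 PA2 hA2]] : exists A : set Omega, [/\ measurable A,
    (P A <= (4 * #|'I_N|%:R * expR (- (3 / 2 * Lg)))%:E)%E
    & forall w, ~ A w -> \sum_j normc (M%:R^-1 * (\sum_m Y j (X m w))
         - cintegral rho setT (Y j)) ^+ 2 <= (kappa / J) * \sum_j \sum_s v2 j s].
  apply: (@complex_family_tail_le _ _ _ _ _ _ rho M X _ Y B) => //.
  - by move=> j s; rewrite lerDl ltW.
  - by rewrite divr_gt0.
  - by move=> j s; rewrite (lt_le_trans s00).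
  - move=> j s; apply: le_trans (v2s j s).
    rewrite mulrA ler_pdivrMr// -(ler_pdivrMl _ _ s00).
    by near: J; apply: nbhs_pinfty_ge; exact: num_real.
  - rewrite ler_expR lerN2.
    (* 5 / 16 * (361 * 6 / 440) = 1.538..., just above 3 / 2 *)
    have : 361 * 6 / 440 * Lg <= M%:R * (kappa / J).
      have -> : 361 * 6 / 440 * Lg = (6 * Q * J / sigma ^+ 2 * Lg) * (kappa / J).
        by rewrite /kappa; field; rewrite !gt_eqF.
      by rewrite ler_wpM2r// ltW// divr_gt0.
    by move: (M%:R * _) => y; lra.
exists (A1 `|` A2); split; first exact: measurableU.
  apply: (le_trans (measureU2 _ _ _)) => //; apply: (le_trans (leeD PA1 PA2)).
  rewrite -EFinD lee_fin card_prod !card_ord.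
  have := failure_budget N1 xi0 xi1; rewrite -/Lg natrM => h.
  have -> : 4 * (N%:R * N%:R) * r1 = xi / 4.
    by rewrite /r1; field; rewrite gt_eqF//; lra.
  lra.
move=> w /not_orP[nA1 nA2]; set G := empirical_gram _.
apply: (@invmx_gram_close _ _ G a (sigma ^+ 2 / J * n)).
- rewrite /nsq pair_bigA /=.
  have := hA1 w nA1; rewrite !sumr_const card_prod card_bool !card_ord => h.
  apply: le_trans (le_trans h _).
    rewrite le_eqVlt; apply/orP; left; apply/eqP; apply: eq_bigr => -[i j] _ /=.
    by rewrite !mxE meang.
  rewrite -[_ *+ (N * N)]mulr_natl -[_ *+ 2]mulr_natl natrM /k1.
  have N0' : N%:R != 0 :> R by rewrite gt_eqF// (lt_le_trans ltr01 N1).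
  have v10 : v1 != 0 by rewrite gt_eqF// (lt_le_trans ltr01 v11).
  have -> : (800 * N%:R ^+ 2 * v1)^-1 * (N%:R * N%:R * (2 * v1)) = 400^-1 :> R.
    by field; rewrite ?N0' ?v10.
  by [].
- apply: le_trans (le_trans (hA2 w nA2) _).
    rewrite nsq_row le_eqVlt; apply/orP; left; apply/eqP; apply: eq_bigr => j _.
    rewrite !mxE mY; congr (normc (_ - _) ^+ 2).
    under eq_bigr do rewrite mxE mulrCA.
    by rewrite -mulr_sumr exchange_big /=; congr (_ * _); apply: eq_bigr => i _; rewrite mulr_sumr.
  apply: (@le_trans _ _ (kappa / J * (11 / 10 * (Q * n)))).
    by rewrite ler_wpM2l// ltW// divr_gt0.
  rewrite le_eqVlt; apply/orP; left; apply/eqP.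
  by rewrite /kappa -/n; field; rewrite !gt_eqF.
Unshelve. all: by end_near. Qed.

End Concentration.

(** * Sampling with density [tau2] *)

Lemma nnratio_ge (R : realType) (a b r : R) : 0 < r -> 0 <= a -> 0 <= b ->
  (r%:E <= nnratio a b)%E = (a != 0) && (r * b <= a).
Proof.
move=> r0 a0 b0; rewrite /nnratio; have [->|bn0] := eqVneq b 0.
  rewrite mulr0 a0 andbT; case: eqVneq => _ /=; last by rewrite leey.
  by rewrite lee_fin leNgt r0.
have {}b0 : 0 < b by rewrite lt_neqAle eq_sym bn0.
rewrite lee_fin ler_pdivlMr//.
have [->|//] := eqVneq a 0; rewrite /=.
by apply/negbTE; rewrite -ltNge mulr_gt0.
Qed.

Section ChristoffelWeighting.
Context {R : realType} {d} {T : measurableType d}.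
Context (mu : {measure set T -> \bar R}) (rho : probability T R).
Context (D : set T) (tau2 : T -> R).
Context (mD : measurable D).
Context (tau0 : forall x, D x -> 0 <= tau2 x).
Context (mtau : measurable_fun D tau2).
Context (hrho : is_density mu D rho tau2).

Lemma ge0_integral_density (h : T -> R) :
  measurable_fun setT h -> (forall x, 0 <= h x) ->
  (\int[mu]_(x in D) (tau2 x * h x)%:E = \int[rho]_x (h x)%:E)%E.
Proof.
move=> mh h0; rewrite -[RHS]mul1e.
apply: (ge0_integral_transfer (X := id) (rho := rho)) => //.
move=> B mB; rewrite mul1e; apply: etrans (esym (hrho mB)).
rewrite integral_mkcondr; apply: eq_integral => x _.
by rewrite patchE indicE /=; case: ifP => _; rewrite ?mulr1 ?mulr0.
Qed.

Lemma integral_density (h : T -> R) : measurable_fun setT h ->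
  (\int[mu]_(x in D) (tau2 x * h x)%:E = \int[rho]_x (h x)%:E)%E.
Proof.
move=> mh; rewrite integralE [RHS]integralE.
pose hp x := Num.max (h x) 0; pose hn x := Num.max (- h x) 0.
have mhp : measurable_fun setT hp by exact: measurable_maxr.
have mhn : measurable_fun setT hn by apply: measurable_maxr => //; exact: measurableT_comp.
have hp0 x : 0 <= hp x by rewrite le_max lexx orbT.
have hn0 x : 0 <= hn x by rewrite le_max lexx orbT.
congr (_ - _)%E.
- rewrite [RHS](_ : _ = \int[rho]_x (hp x)%:E)%E; last first.
    by apply: eq_integral => x _; rewrite funeposE -EFin_max.
  rewrite -ge0_integral_density//; apply: eq_integral => x; rewrite inE => Dx.
  by rewrite funeposE -EFin_max -{1}(mulr0 (tau2 x)) -maxr_pMr ?tau0.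
- rewrite [RHS](_ : _ = \int[rho]_x (hn x)%:E)%E; last first.
    by apply: eq_integral => x _; rewrite funenegE -EFinN -EFin_max.
  rewrite -ge0_integral_density//; apply: eq_integral => x; rewrite inE => Dx.
  by rewrite funenegE -EFinN -EFin_max -{1}(mulr0 (tau2 x)) -mulrN -maxr_pMr ?tau0.
Qed.

Context {N : nat} (phi : 'I_N -> T -> R[i]).
Context (mphi : forall n, cmeasurable D (phi n)).
Context (hcov : coverage phi mu D tau2).
Context (Qfin : (Qsup phi rho tau2 < +oo)%E).

Local Notation k := (kfun phi).
Definition christoffel_bound := fine (Qsup phi rho tau2).
Local Notation Q := christoffel_bound.

(** A set of full [rho]-measure on which the defining bounds hold pointwise;
    observables are cut off outside it, which makes them bounded and measurable
    on the whole space. *)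
Definition good_set := D `&` [set x | 0 < tau2 x] `&` [set x | k x <= Q * tau2 x].
Local Notation D0 := good_set.

Lemma kfun_ge0 x : 0 <= k x.
Proof. by apply: sumr_ge0 => n _; exact: sqr_ge0. Qed.

Lemma measurable_part s (u : T -> R[i]) : cmeasurable D u ->
  measurable_fun D (fun x => part s (u x)).
Proof. by case: s => -[]. Qed.

Lemma measurable_normc_sq (u : T -> R[i]) : cmeasurable D u ->
  measurable_fun D (fun x => normc (u x) ^+ 2).
Proof.
move=> mu'; under eq_fun do rewrite normc_sq_parts.
by apply: measurable_sum => s; apply: measurable_funX; exact: measurable_part.
Qed.

Lemma measurable_kfun : measurable_fun D k.
Proof. by apply: measurable_sum => n; exact: measurable_normc_sq. Qed.

Lemma measurable_pos_tau2 : measurable (D `&` [set x | 0 < tau2 x]).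
Proof.
have m0 : measurable_fun D (fun=> 0 : R) by exact: measurable_cst.
have := measurable_fun_ltr m0 mtau mD.
by move=> /(_ [set true]); exact.
Qed.

Lemma measurable_good_set : measurable D0.
Proof.
have -> : D0 = (D `&` [set x | 0 < tau2 x]) `&` (D `&` [set x | k x <= Q * tau2 x]).
  by apply/seteqP; split=> [x [[]]|x [[? ?] []]].
apply: measurableI; first exact: measurable_pos_tau2.
apply: measurable_fun_le => //; first exact: measurable_kfun.
exact: measurable_funM.
Qed.

Lemma good_set_subset : D0 `<=` D. Proof. by move=> x [[]]. Qed.

Lemma Qsup_ae : {ae rho, forall x, 0 < tau2 x -> k x <= Q * tau2 x}.
Proof.
have := ess_sup_ge rho (fun x => nnratio (k x) (tau2 x)).
apply: filterS => x + t0; rewrite -/(Qsup phi rho tau2) /nnratio gt_eqF// => h.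
have : (Qsup phi rho tau2 = Q%:E)%E.
  rewrite /christoffel_bound fineK// fin_real// Qfin andbT.
  exact: lt_le_trans (ltNyr _) h.
by move=> QE; move: h; rewrite QE lee_fin ler_pdivrMr.
Qed.

Lemma rho_setC_D : rho (~` D) = 0%E.
Proof. by apply: etrans (hrho (measurableC mD)) _; rewrite setICr integral_set0. Qed.

Lemma rho_good_setC : rho (~` D0) = 0%E.
Proof.
apply: measure_negligible; first exact/measurableC/measurable_good_set.
have m0 : measurable (D `&` [set x | tau2 x <= 0]) by exact: measurable_fun_le.
have n0 : rho.-negligible (D `&` [set x | tau2 x <= 0]).
  apply/negligibleP => //; apply: etrans (hrho m0) _; rewrite setIA setIid.
  rewrite -[RHS](integral0 mu (D `&` [set x | tau2 x <= 0])).
  apply: eq_integral => x; rewrite inE => -[Dx tx]; congr (_%:E).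
  by apply/eqP; rewrite eq_le tx tau0.
have nD : rho.-negligible (~` D).
  by apply/negligibleP; [exact: measurableC|exact: rho_setC_D].
apply: negligibleS (negligibleU (negligibleU nD n0) Qsup_ae) => x nx.
have [Dx|] := pselect (D x); last by left; left.
have [tx|tx] := leP (tau2 x) 0; first by left; right.
by right => h; apply: nx; split; [split|exact: h].
Qed.

(** By coverage where [tau2 = 0]; elsewhere the complement of the good set is
    [rho]-null with a positive density, hence [mu]-null.  This is why the cut-off
    loses none of the mass of products of elements of the space. *)
Lemma kfun_eq0_ae : {ae mu, forall x, D x -> ~ D0 x -> k x = 0}.
Proof.
pose S := (D `&` [set x | 0 < tau2 x]) `\` D0.
have mS : measurable S.
  by apply: measurableD; [exact: measurable_pos_tau2|exact: measurable_good_set].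
have SD : S `<=` D by move=> x [[]].
have mtS : measurable_fun S (EFin \o tau2).
  by apply/measurable_EFinP; exact: measurable_funS mtau.
have : (\int[mu]_(x in S) `|(tau2 x)%:E| = 0)%E.
  have : rho S = 0%E.
    apply: (subset_measure0 _ _ _ rho_good_setC) => //; last by move=> x [].
    by apply: measurableC; exact: measurable_good_set.
  move=> rS; apply: etrans rS; apply: etrans (esym (hrho mS)).
  rewrite setIC (setIidl SD); apply: eq_integral => x; rewrite inE => Sx.
  by rewrite gee0_abs// lee_fin tau0//; exact: SD.
move=> /(ae_eq_integral_abs mu mS mtS); move: hcov; apply: filterS2 => x hx Sx Dx nx.
have [t0|] := eqVneq (tau2 x) 0; first exact: hx.
rewrite neq_lt ltNge tau0//= => t0.
by have [t1] := Sx (conj (conj Dx t0) nx); move: t0; rewrite t1 ltxx.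
Qed.

Lemma phi_eq0 x n : k x = 0 -> phi n x = 0.
Proof.
move=> /eqP; rewrite psumr_eq0 => [/allP h|? _]; last exact: sqr_ge0.
apply: eq0_normc; apply/eqP.
by have := h n; rewrite mem_index_enum sqrf_eq0; exact.
Qed.

Lemma cmeasurable_conjM (u v : T -> R[i]) : cmeasurable D u -> cmeasurable D v ->
  cmeasurable D (fun x => conjc (u x) * v x).
Proof.
move=> [u1 u2] [v1 v2]; split.
- have -> : (fun x => complex.Re (conjc (u x) * v x)) =
    (fun x => complex.Re (u x) * complex.Re (v x) + complex.Im (u x) * complex.Im (v x)).
    by apply/funext => x; case: (u x) => ? ?; case: (v x) => ? ? /=; ring.
  by apply: measurable_funD; exact: measurable_funM.
- have -> : (fun x => complex.Im (conjc (u x) * v x)) =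
    (fun x => complex.Re (u x) * complex.Im (v x) - complex.Im (u x) * complex.Re (v x)).
    by apply/funext => x; case: (u x) => ? ?; case: (v x) => ? ? /=; ring.
  by apply: measurable_funB; exact: measurable_funM.
Qed.

Lemma cmeasurable_comb (c : 'I_N -> R[i]) :
  cmeasurable D (fun x => \sum_n c n * phi n x).
Proof.
have mcv s : measurable_fun D (fun x => part s (\sum_n c n * phi n x)).
  under eq_fun do rewrite part_sum; apply: measurable_sum => n.
  under eq_fun do rewrite mulrC part_mul.
  by apply: measurable_funD; apply: measurable_funM => //;
    try apply: measurable_funM => //; exact: measurable_part.
by split; [exact: (mcv false)|exact: (mcv true)].
Qed.

(** [1 / tau2] cut off outside the good set. *)
Definition inv_tau2 x := \1_D0 x / tau2 x.

Lemma inv_tau2_good x : D0 x -> inv_tau2 x = (tau2 x)^-1.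
Proof. by move=> Dx; rewrite /inv_tau2 indicE mem_set// mul1r. Qed.

Lemma inv_tau2_bad x : ~ D0 x -> inv_tau2 x = 0.
Proof. by move=> Dx; rewrite /inv_tau2 indicE memNset// mul0r. Qed.

Lemma inv_tau2_ge0 x : 0 <= inv_tau2 x.
Proof.
have [Dx|Dx] := pselect (D0 x); last by rewrite inv_tau2_bad.
by rewrite inv_tau2_good// invr_ge0 tau0//; exact: good_set_subset.
Qed.

Lemma inv_tau2_kfun_le x : inv_tau2 x * k x <= Q * (x \in D0)%:R.
Proof.
have [Dx|Dx] := pselect (D0 x); last by rewrite inv_tau2_bad// mul0r memNset// mulr0.
rewrite inv_tau2_good// mem_set// mulr1 mulrC.
by case: Dx => -[_ t0] h; rewrite ler_pdivrMr.
Qed.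

Lemma measurable_inv_tau2M (u : T -> R) : measurable_fun D u ->
  measurable_fun setT (fun x => inv_tau2 x * u x).
Proof.
move=> mu'.
(* on the good set, 1 / tau2 = exp (- ln tau2) *)
have -> : (fun x => inv_tau2 x * u x) = (fun x => expR (- ln (tau2 x)) * u x) \_ D0.
  apply/funext => x; rewrite patchE; case: ifPn => [/set_mem|/negP] Dx.
    by rewrite inv_tau2_good// expRN lnK// posrE; case: Dx => -[].
  by rewrite inv_tau2_bad ?mul0r// => /mem_set.
apply/(measurable_restrictT _ measurable_good_set).
apply: measurable_funS mD good_set_subset _.
apply: measurable_funM => //; apply: measurableT_comp => //.
by apply: measurableT_comp => //; apply: measurableT_comp => //; exact: measurable_ln.
Qed.

(** The importance-sampling identity. *)
Lemma cintegral_density (u : T -> R[i]) : cmeasurable D u ->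
  (forall x, k x = 0 -> u x = 0) ->
  cintegral mu D u = cintegral rho setT (fun x => (inv_tau2 x)%:C * u x).
Proof.
move=> mu' u0; apply: eq_parts => s.
have -> : part s (cintegral mu D u) = \int[mu]_(x in D) part s (u x) by case: (s).
rewrite part_cintegral; under [RHS]eq_Rintegral do rewrite partZ.
have mp : measurable_fun D (fun x => part s (u x)) by exact: measurable_part.
rewrite /Rintegral -integral_density; last exact: measurable_inv_tau2M.
congr fine; apply: ae_eq_integral => //.
- exact/measurable_EFinP.
- apply/measurable_EFinP; apply: measurable_funM => //.
  by apply: measurable_funS (measurable_inv_tau2M mp).
move: kfun_eq0_ae; apply: filterS => x kx Dx; congr (_%:E).
have [D0x|D0x] := pselect (D0 x).
  rewrite inv_tau2_good// mulrA divff ?mul1r//.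
  by case: D0x => -[_ /lt0r_neq0].
by rewrite inv_tau2_bad// mul0r mulr0 u0 ?part0// kx.
Qed.

(** The Gram matrix of the single sample [x]. *)
Definition sample_gram i j x := (inv_tau2 x)%:C * (conjc (phi i x) * phi j x).

Context (hphi : orthonormal_family phi mu D).
Context (N0 : (0 < N)%N).

Lemma cmeasurable_phiM i j : cmeasurable D (fun x => conjc (phi i x) * phi j x).
Proof. exact: cmeasurable_conjM. Qed.

Lemma mean_sample_gram i j : cintegral rho setT (sample_gram i j) = (i == j)%:R.
Proof.
rewrite -hphi /inner cintegral_density//; first exact: cmeasurable_phiM.
by move=> x kx; rewrite (phi_eq0 j kx) mulr0.
Qed.

Lemma normc_phi_le n x : normc (phi n x) ^+ 2 <= k x.
Proof. by rewrite /kfun (bigD1 n)//= lerDl sumr_ge0// => i _; exact: sqr_ge0. Qed.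

Lemma normc_sample_gram_le_inv_tau2 i j x : normc (sample_gram i j x) <= inv_tau2 x * k x.
Proof.
rewrite /sample_gram !normcM normc_conj normc_real ?inv_tau2_ge0// ler_wpM2l ?inv_tau2_ge0//.
have := normc_phi_le i x; have := normc_phi_le j x.
have := sqr_ge0 (normc (phi i x) - normc (phi j x)).
by move: (normc _) (normc _) (k x) => p q r; nra.
Qed.

(** If the bound vanished, so would the one-sample Gram matrix, whose mean is
    the identity. *)
Lemma christoffel_bound_gt0 : 0 < Q.
Proof.
rewrite ltNge; apply/negP => Q0.
have f0 i : sample_gram i i = fun=> 0.
  apply/funext => x; apply: eq0_normc; apply/eqP; rewrite eq_le normc_ge0 andbT.
  rewrite (le_trans (normc_sample_gram_le_inv_tau2 _ _ _))//.
  rewrite (le_trans (inv_tau2_kfun_le _))// mulr_le0_ge0//.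
have := mean_sample_gram (Ordinal N0) (Ordinal N0); rewrite eqxx f0.
rewrite /cintegral /= /Rintegral !integral0 => /eqP.
by rewrite eq_complex /= eq_sym oner_eq0.
Qed.

Lemma inv_tau2_kfun_leQ x : inv_tau2 x * k x <= Q.
Proof.
rewrite (le_trans (inv_tau2_kfun_le _))// -[leRHS]mulr1 ler_wpM2l ?(ltW christoffel_bound_gt0)//.
by case: (_ \in _).
Qed.

Lemma normc_sample_gram_le i j x : normc (sample_gram i j x) <= Q.
Proof. exact: le_trans (normc_sample_gram_le_inv_tau2 _ _ _) (inv_tau2_kfun_leQ _). Qed.

Lemma cbounded_sample_gram i j : cbounded (sample_gram i j).
Proof.
move=> s; split; last first.
  by exists Q => x; exact: le_trans (part_le _ _) (normc_sample_gram_le _ _ _).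
under eq_fun do rewrite /sample_gram partZ.
by apply: measurable_inv_tau2M; apply: measurable_part; exact: cmeasurable_phiM.
Qed.

(** The one-sample Gram matrix has rank at most one, and its only possibly
    nonzero eigenvalue is its trace [inv_tau2 x * k x <= Q]. *)
Lemma sum_sample_gram_sq_le (a : 'rV[R[i]]_N) x :
  \sum_j normc (\sum_i a 0 i * sample_gram i j x) ^+ 2 <=
  Q * complex.Re (\sum_i a 0 i * (\sum_j conjc (a 0 j) * sample_gram i j x)).
Proof.
pose L := \sum_i a 0 i * conjc (phi i x).
have -> : \sum_j normc (\sum_i a 0 i * sample_gram i j x) ^+ 2 =
    inv_tau2 x * k x * (inv_tau2 x * normc L ^+ 2).
  rewrite -mulrA mulrCA /kfun mulr_suml; apply: eq_bigr => j _.
  have -> : \sum_i a 0 i * sample_gram i j x = (inv_tau2 x)%:C * (L * phi j x).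
    rewrite /L mulr_suml mulr_sumr; apply: eq_bigr => i _.
    by rewrite /sample_gram mulrCA -!mulrA; congr (_ * _); rewrite mulrA.
  rewrite !normcM normc_real ?inv_tau2_ge0//.
  by move: (inv_tau2 x) (normc L) => w l; ring.
have -> : \sum_i a 0 i * (\sum_j conjc (a 0 j) * sample_gram i j x) =
    (inv_tau2 x * normc L ^+ 2)%:C.
  have cL : conjc L = \sum_j conjc (a 0 j) * phi j x.
    by rewrite rmorph_sum; apply: eq_bigr => j _; rewrite rmorphM /= conjcK.
  rewrite rmorphM /= -conjc_mul cL {1}/L mulr_suml mulr_sumr; apply: eq_bigr => i _.
  rewrite mulrCA -!mulrA; congr (_ * _); rewrite !mulr_sumr; apply: eq_bigr => j _.
  by rewrite /sample_gram; ring.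
by rewrite ler_wpM2r ?inv_tau2_kfun_leQ// mulr_ge0 ?inv_tau2_ge0// sqr_ge0.
Qed.

Lemma spanned_comb b (u v : T -> R[i]) : spanned phi u -> spanned phi v ->
  spanned phi (fun x => b * u x + v x).
Proof.
move=> [c ->] [c' ->]; exists (fun n => b * c n + c' n); apply/funext => x.
by rewrite mulr_sumr -big_split /=; apply: eq_bigr => n _; ring.
Qed.

Lemma spanned0 : spanned phi (fun=> 0).
Proof. by exists (fun=> 0); apply/funext => x; rewrite big1// => n _; rewrite mul0r. Qed.

Lemma spanned_phi n : spanned phi (phi n).
Proof.
exists (fun j => (j == n)%:R); apply/funext => x.
rewrite (bigD1 n)//= eqxx mul1r big1 ?addr0// => j jn.
by rewrite (negbTE jn) mul0r.
Qed.

Lemma L2norm_comb (c : 'I_N -> R[i]) :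
  L2norm mu D (fun x => \sum_n c n * phi n x) = Num.sqrt (\sum_n normc (c n) ^+ 2).
Proof.
rewrite /L2norm /inner; congr Num.sqrt.
set v := fun x => \sum_n c n * phi n x.
have mv : cmeasurable D v by exact: cmeasurable_comb.
rewrite cintegral_density; last 2 first.
- exact: cmeasurable_conjM.
- move=> x kx; rewrite /v [X in _ * X]big1 ?mulr0// => n _.
  by rewrite phi_eq0// mulr0.
have -> : (fun x => (inv_tau2 x)%:C * (conjc (v x) * v x)) =
    fun x => \sum_i conjc (c i) * (\sum_j c j * sample_gram i j x).
  apply/funext => x; have -> : conjc (v x) = \sum_i conjc (c i) * conjc (phi i x).
    by rewrite rmorph_sum; apply: eq_bigr => i _; rewrite rmorphM.
  rewrite mulr_suml mulr_sumr; apply: eq_bigr => i _.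
  rewrite [in LHS]mulr_sumr !mulr_sumr; apply: eq_bigr => j _.
  by rewrite /sample_gram; ring.
have bf i : cbounded (fun x => \sum_j c j * sample_gram i j x).
  by apply: cbounded_sum => j; apply: cboundedZ; exact: cbounded_sample_gram.
rewrite cmean_sum => [|i]; last exact: cboundedZ.
rewrite -[LHS]/(part false _) part_sum; apply: eq_bigr => i _.
rewrite cmeanZ// cmean_sum => [|j]; last by apply: cboundedZ; exact: cbounded_sample_gram.
rewrite (bigD1 i)//= cmeanZ ?mean_sample_gram ?eqxx ?mulr1; last exact: cbounded_sample_gram.
rewrite big1 => [|j ji]; last first.
  rewrite cmeanZ; last exact: cbounded_sample_gram.
  by rewrite mean_sample_gram eq_sym (negbTE ji) mulr0.
by rewrite addr0 mulrC conjc_mul.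
Qed.

Context (F : (T -> R[i]) -> R[i]).
Context (hF : linear_on_span phi F).

Lemma functional_comb (c : 'I_N -> R[i]) :
  F (fun x => \sum_n c n * phi n x) = \sum_n c n * F (phi n).
Proof.
have F0 : F (fun=> 0) = 0.
  have := hF 1 spanned0 spanned0.
  have -> : (fun=> 1 * 0 + 0 : R[i]) = (fun _ : T => 0).
    by apply/funext => x; rewrite mulr0 addr0.
  by rewrite mul1r => /eqP; rewrite -subr_eq0 opprD addrA subrr sub0r oppr_eq0 => /eqP.
suff [] : spanned phi (fun x => \sum_(n <- index_enum 'I_N) c n * phi n x) /\
  F (fun x => \sum_n c n * phi n x) = \sum_n c n * F (phi n) by [].
elim: (index_enum _) => [|n r [sr IH]].
  under eq_fun do rewrite big_nil; rewrite big_nil; split; [exact: spanned0|exact: F0].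
under eq_fun do rewrite big_cons; rewrite big_cons; split.
  by apply: spanned_comb => //; exact: spanned_phi.
by rewrite hF ?IH//; exact: spanned_phi.
Qed.

Definition coefs : 'rV[R[i]]_N := \row_n F (phi n).

Lemma nsq_coefs : nsq coefs = \sum_n normc (F (phi n)) ^+ 2.
Proof. by rewrite nsq_row; apply: eq_bigr => n _; rewrite mxE. Qed.

(** Evaluates the functional at its normalized Riesz representer; if the
    functional vanishes on the span, [r^-1 = 0] makes that representer zero.
    The Cauchy-Schwarz inequality makes the set under the supremum bounded. *)
Lemma dual_norm_ge : Num.sqrt (nsq coefs) <= dual_norm phi F mu D.
Proof.
set r := Num.sqrt _.
have r0 : 0 <= r by exact: sqrtr_ge0.
have r2 : r ^+ 2 = \sum_n normc (F (phi n)) ^+ 2.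
  by rewrite sqr_sqrtr ?nsq_ge0// nsq_coefs.
apply: ub_le_sup.
  exists r => _ [_ [[c ->]]] + <-; rewrite L2norm_comb functional_comb => c1.
  rewrite -ler_sqr ?nnegrE ?normc_ge0//.
  have h : normc (\sum_n c n * F (phi n)) <= \sum_n normc (c n) * normc (F (phi n)).
    by rewrite (le_trans (normc_sum _ _ _))// ler_sum// => n _; rewrite normcM.
  rewrite -ler_sqr ?nnegrE ?normc_ge0 ?sumr_ge0// in h; last first.
    by move=> n _; rewrite mulr_ge0 ?normc_ge0.
  apply: (le_trans h); apply: (le_trans (cauchy_schwarz_sum _ _)).
  rewrite -r2 ler_piMl ?sqr_ge0//.
  by rewrite -(ler_sqrt _ ler01) sqrtr1.
pose c n := conjc (F (phi n)) * (r^-1)%:C.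
exists (fun x => \sum_n c n * phi n x); first split.
- by exists c.
- rewrite L2norm_comb.
  have -> : \sum_n normc (c n) ^+ 2 = r ^+ 2 * r^-1 ^+ 2.
    rewrite r2 mulr_suml; apply: eq_bigr => n _.
    by rewrite normcM normc_conj normc_real ?invr_ge0// exprMn.
  rewrite -exprMn sqrtr_sqr; have [->|rn0] := eqVneq r 0.
    by rewrite mul0r normr0.
  by rewrite divff// normr1.
rewrite functional_comb.
have -> : \sum_n c n * F (phi n) = (r ^+ 2 * r^-1)%:C.
  rewrite r2 mulr_suml rmorph_sum; apply: eq_bigr => n _ /=.
  by rewrite rmorphM /= -conjc_mul /c; ring.
rewrite normc_real ?mulr_ge0 ?sqr_ge0 ?invr_ge0//.
by have [->|rn0] := eqVneq r 0; rewrite ?expr0n ?mul0r// expr2 mulfK.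
Qed.

Section Rule.
Context {M : nat} (x : 'I_M -> T).
Local Notation G := (gram phi tau2 x).
Local Notation y := (coefs *m invmx G).

(** At good points the cut-off is invisible. *)
Lemma gram_sample_gram : (forall m, D0 (x m)) -> G = empirical_gram sample_gram x.
Proof.
move=> Dx; apply/matrixP => i j; rewrite !mxE; congr (_ * _); apply: eq_bigr => m _.
by rewrite /sample_gram inv_tau2_good// mulrC fmorphV.
Qed.

Lemma ls_weightE m : ls_weight phi F tau2 x m =
  (M%:R)^-1 * ((tau2 (x m))%:C)^-1 * \sum_i y 0 i * conjc (phi i (x m)).
Proof.
rewrite /ls_weight invfM mxE; congr (_ * _); apply: eq_bigr => i _.
by congr (_ * _); rewrite mxE.
Qed.

Lemma ls_rule_exact : ls_well_defined phi tau2 x -> exact_on_span phi F tau2 x.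
Proof.
move=> uG _ [c ->]; rewrite functional_comb.
have yG : y *m G = coefs by rewrite mulmxKV.
transitivity (\sum_j c j * (y *m G) 0 j); last first.
  by rewrite yG; apply: eq_bigr => j _; rewrite mxE.
rewrite /ls_rule; under eq_bigr do rewrite mulr_sumr.
rewrite exchange_big /=; apply: eq_bigr => j _.
rewrite mxE; under [in RHS]eq_bigr => i _ do rewrite [G i j]mxE !mulr_sumr.
rewrite exchange_big /= mulr_sumr; apply: eq_bigr => m _.
by rewrite ls_weightE mulr_sumr mulr_suml mulr_sumr; apply: eq_bigr => i _; ring.
Qed.

(** On the good set this is [tau2 * Xi]: multiplying the error bound by [tau2]
    gives both modes the same form, [|e . conj phi| <= sigma * envelope]. *)
Definition envelope (s : mode) (z : T) : R :=
  match s with relative => normc (riesz phi F z) | absolute => tau2 z end.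

Lemma ls_weight_close s m (sigma J : R) : (0 < M)%N -> 0 < sigma -> 0 < J ->
  D0 (x m) -> nsq (y - coefs) <= sigma ^+ 2 / J * nsq coefs ->
  nsq coefs * k (x m) <= J * envelope s (x m) ^+ 2 ->
  normc (M%:R * ls_weight phi F tau2 x m - omega phi F tau2 (x m)) <=
    sigma * Xi phi F s tau2 (x m).
Proof.
move=> M0 s0 J0 D0x hy hk; set z := x m in D0x hk *.
have t0 : 0 < tau2 z by case: D0x => -[].
pose S := \sum_i (y - coefs) 0 i * conjc (phi i z).
have cR : conjc (riesz phi F z) = \sum_i coefs 0 i * conjc (phi i z).
  rewrite rmorph_sum; apply: eq_bigr => i _.
  by rewrite rmorphM /= conjcK mxE.
have -> : M%:R * ls_weight phi F tau2 x m - omega phi F tau2 z = ((tau2 z)^-1)%:C * S.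
  rewrite ls_weightE -/z /omega gt_eqF// cR fmorphV !mulrA mulfV ?mul1r; last first.
    by rewrite pnatr_eq0 -lt0n.
  rewrite [_ / _]mulrC -mulrBr -sumrB; congr (_ * _); apply: eq_bigr => i _.
  by rewrite -mulrBl; congr (_ * _); rewrite !mxE.
have hS : normc S <= sigma * envelope s z.
  have h0 : 0 <= envelope s z by case: (s) => /=; rewrite ?normc_ge0 ?ltW.
  have sh0 : 0 <= sigma * envelope s z by rewrite mulr_ge0// ltW.
  rewrite -ler_sqr ?nnegrE ?normc_ge0//.
  have h : normc S <= \sum_i normc ((y - coefs) 0 i) * normc (phi i z).
    rewrite (le_trans (normc_sum _ _ _))// ler_sum// => i _.
    by rewrite normcM normc_conj.
  rewrite -ler_sqr ?nnegrE ?normc_ge0 ?sumr_ge0// in h; last first.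
    by move=> i _; rewrite mulr_ge0 ?normc_ge0.
  apply: (le_trans h); apply: (le_trans (cauchy_schwarz_sum _ _)).
  rewrite -nsq_row -/(k z).
  apply: (@le_trans _ _ (sigma ^+ 2 / J * nsq coefs * k z)).
    by rewrite ler_wpM2r// kfun_ge0.
  rewrite -mulrA; apply: (@le_trans _ _ (sigma ^+ 2 / J * (J * envelope s z ^+ 2))).
    by rewrite ler_wpM2l// divr_ge0 ?sqr_ge0// ltW.
  by rewrite mulrA divfK ?gt_eqF// exprMn.
have tV0 : 0 <= (tau2 z)^-1 by rewrite invr_ge0 ltW.
rewrite normcM normc_real// mulrC ler_pdivrMr// -mulrA.
suff -> : Xi phi F s tau2 z * tau2 z = envelope s z by [].
case: (s) => /=; last by rewrite mul1r.
rewrite /omega gt_eqF// normcM normc_conj -fmorphV normc_real//.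
by rewrite divfK// gt_eqF.
Qed.

End Rule.

Local Notation dn := (dual_norm phi F mu D).

(** The event of [p_J], resp. [q_J], with square roots and quotients cleared. *)
Definition tail_set s (J : R) := D `&` [set z | (dn ^+ 2 * k z != 0) &&
  (J * envelope s z ^+ 2 <= dn ^+ 2 * k z)].

Lemma dual_norm_ge0 : 0 <= dn.
Proof. exact: le_trans (sqrtr_ge0 _) dual_norm_ge. Qed.

Lemma cmeasurable_riesz : cmeasurable D (riesz phi F).
Proof. exact: (cmeasurable_comb (fun n => conjc (F (phi n)))). Qed.

Lemma measurable_tail_set s J : measurable (tail_set s J).
Proof.
have mk : measurable_fun D (fun z => dn ^+ 2 * k z).
  by apply: measurable_funM => //; exact: measurable_kfun.
have mh : measurable_fun D (fun z => J * envelope s z ^+ 2).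
  apply: measurable_funM => //; case: (s) => /=.
    by apply: measurable_normc_sq; exact: cmeasurable_riesz.
  exact: measurable_funX.
have mb : measurable_fun D
    (fun z => (dn ^+ 2 * k z != 0) && (J * envelope s z ^+ 2 <= dn ^+ 2 * k z)).
  apply: measurable_and; last exact: measurable_fun_ler.
  apply: measurable_neg; apply: measurable_fun_eqr => //; exact: measurable_cst.
by have := mb mD [set true]; exact.
Qed.

Lemma not_tail_set s J z : D z -> ~ tail_set s J z -> 0 <= J ->
  nsq coefs * k z <= J * envelope s z ^+ 2.
Proof.
move=> Dz nz J0; have h : nsq coefs * k z <= dn ^+ 2 * k z.
  rewrite ler_wpM2r ?kfun_ge0//.
  rewrite -(sqr_sqrtr (nsq_ge0 coefs)) ler_sqr ?nnegrE ?sqrtr_ge0 ?dual_norm_ge0//.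
  exact: dual_norm_ge.
apply: (le_trans h); rewrite leNgt; apply/negP => h2; apply: nz; split=> //=.
by rewrite (ltW h2) andbT gt_eqF// (le_lt_trans _ h2)// mulr_ge0// sqr_ge0.
Qed.

Lemma nsq_coefs_gt0 : (exists2 v, spanned phi v & F v != 0) -> 0 < nsq coefs.
Proof.
move=> [_ [c ->]]; rewrite functional_comb => Fc; rewrite lt_neqAle nsq_ge0 andbT eq_sym.
apply/eqP => /nsq_row_eq0/rowP c0; move: Fc; rewrite big1 ?eqxx// => n _.
by have := c0 n; rewrite !mxE => ->; rewrite mulr0.
Qed.

(** [1 < J] excludes the points with [k = 0], where [cos_gamma] is [1]. *)
Lemma p_relE J : 1 < J -> (exists2 v, spanned phi v & F v != 0) ->
  p_rel phi F mu D rho J = fine (rho (tail_set relative J)).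
Proof.
move=> J1 /nsq_coefs_gt0 c0.
have dn0 : 0 < dn by rewrite (lt_le_trans _ dual_norm_ge)// sqrtr_gt0.
have J0 : 0 < J by rewrite (lt_trans ltr01).
congr (fine (rho (_ `&` _))); apply/seteqP.
have E z : ((Num.sqrt J)%:E <= nnratio 1 (cos_gamma phi F mu D z))%E =
    (dn ^+ 2 * k z != 0) && (J * normc (riesz phi F z) ^+ 2 <= dn ^+ 2 * k z).
  rewrite /cos_gamma nnratio_ge ?sqrtr_gt0 ?oner_eq0//=; last first.
    case: ifP => // _; by rewrite divr_ge0 ?normc_ge0// mulr_ge0 ?sqrtr_ge0// ltW.
  rewrite mulf_eq0 sqrf_eq0 (gt_eqF dn0)/=.
  case: eqVneq => [kz|kz] /=.
    by apply/negbTE; rewrite mulr1 -ltNge -sqrtr1 ltr_sqrt.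
  have k0 : 0 < k z by rewrite lt_neqAle eq_sym kz kfun_ge0.
  rewrite mulrA ler_pdivrMr ?mulr_gt0 ?sqrtr_gt0// mul1r.
  rewrite -[LHS]ler_sqr ?nnegrE ?mulr_ge0 ?sqrtr_ge0 ?normc_ge0 ?(ltW dn0)//.
  by rewrite !exprMn !sqr_sqrtr// ltW.
by split=> z /=; rewrite E.
Qed.

Lemma q_absE J : 0 < J ->
  q_abs phi F mu D rho tau2 J = fine (rho (tail_set absolute J)).
Proof.
move=> J0; congr (fine (rho _)).
have E z : D z -> ((Num.sqrt J)%:E <= nnratio (dn * Num.sqrt (k z))%R (tau2 z))%E =
    (dn ^+ 2 * k z != 0) && (J * tau2 z ^+ 2 <= dn ^+ 2 * k z).
  move=> Dz; have dk0 : 0 <= dn * Num.sqrt (k z).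
    by rewrite mulr_ge0 ?sqrtr_ge0 ?dual_norm_ge0.
  rewrite nnratio_ge ?sqrtr_gt0 ?tau0//; congr (~~ _ && _).
    by rewrite [LHS]mulf_eq0 [RHS]mulf_eq0 sqrf_eq0 sqrtr_eq0 (eq_le (k z)) kfun_ge0 andbT.
  rewrite -[LHS]ler_sqr ?nnegrE ?mulr_ge0 ?sqrtr_ge0 ?tau0 ?dual_norm_ge0//.
  by rewrite !exprMn !sqr_sqrtr ?kfun_ge0// ltW.
by apply/seteqP; split=> z [Dz]; rewrite /= E.
Qed.

(** If the functional vanishes, only the invertibility of the Gram matrix is at
    stake, and the vector of ones is used in place of [coefs]. *)
Lemma coefs_concentration (sigma xi : R) : 0 < sigma -> 0 < xi -> xi < 1 ->
  \forall J \near +oo, forall M,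
    6 * Q * J / sigma ^+ 2 * ln (4 * N%:R / xi) <= M%:R ->
    forall d' (Omega : measurableType d') (P : probability Omega R)
      (X : 'I_M -> {RV P >-> T}),
    independent_samples rho X ->
    exists A : set Omega, [/\ measurable A, (P A <= (3 / 4 * xi)%:E)%E
      & forall w, ~ A w -> let G := empirical_gram sample_gram (fun m => X m w) in
          G \in unitmx /\
          nsq (coefs *m invmx G - coefs) <= sigma ^+ 2 / J * nsq coefs].
Proof.
move=> s0 x0 x1.
have core a : a != 0 -> _ := fun a0 => gram_inverse_concentration (a := a) N0
  christoffel_bound_gt0 cbounded_sample_gram normc_sample_gram_le mean_sample_gram
  (sum_sample_gram_sq_le a) a0 s0 x0 x1.
have [c0|] := eqVneq coefs 0; last exact: core.
have one0 : const_mx 1 != 0 :> 'rV[R[i]]_N.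
  by apply/eqP => /rowP/(_ (Ordinal N0)); rewrite !mxE; apply/eqP/oner_neq0.
apply: filterS (core _ one0) => J h M hM d' Omega P X ind.
have [A [mA PA hA]] := h M hM d' Omega P X ind; exists A; split=> // w nA /=.
have [uG _] := hA w nA; split=> //.
rewrite c0 mul0mx subr0 (_ : nsq 0 = 0) ?mulr0//.
by rewrite /nsq big1// => i _; rewrite big1// => j _; rewrite mxE normc0 expr0n.
Qed.

Lemma tail_set_small s : admissible phi F s mu D rho tau2 ->
  J * fine (rho (tail_set s J)) @[J --> +oo] --> (0 : R).
Proof.
case: s => [[nF _ hp]|[_ hq]].
- apply: cvg_trans hp; apply: near_eq_cvg; near=> J.
  by rewrite p_relE//; near: J; apply: nbhs_pinfty_gt; exact: num_real.
- apply: cvg_trans hq; apply: near_eq_cvg; near=> J.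
  by rewrite q_absE//; near: J; apply: nbhs_pinfty_gt; exact: num_real.
Unshelve. all: by end_near. Qed.

Theorem christoffel_quadrature (s : mode) (sigma xi : R) :
  admissible phi F s mu D rho tau2 -> 0 < sigma -> 0 < xi -> xi < 1 ->
  exists (J : R) (M : nat),
    [/\ 1 <= J,
        6 * Q * J / sigma ^+ 2 * ln (4 * N%:R / xi) <= M%:R,
        M%:R <= 7 * Q * J / sigma ^+ 2 * ln (4 * N%:R / xi)
      & forall (d' : measure_display) (Omega : measurableType d')
          (P : probability Omega R) (X : 'I_M -> {RV P >-> T}),
          independent_samples rho X ->
          with_probability_at_least P (1 - xi)
            [set w | let x := fun m => X m w in
              [/\ ls_well_defined phi tau2 x,
                  exact_on_span phi F tau2 x
                & forall m,
                    normc (M%:R * ls_weight phi F tau2 x m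
                           - omega phi F tau2 (x m))
                      <= sigma * Xi phi F s tau2 (x m)]]].
Proof.
move=> adm s0 x0 x1.
have N1 : 1 <= N%:R :> R by rewrite ler1n.
set Lg := ln _.
have Lg0 : 0 < Lg by rewrite ln_gt0// ltr_pdivlMr//; nra.
(* the interval for [M] is [6 c J, 7 c J], of length at least 1 for large [J] *)
pose c := Q / sigma ^+ 2 * Lg.
have c0 : 0 < c.
  by rewrite mulr_gt0// divr_gt0 ?christoffel_bound_gt0// exprn_gt0.
have EJ n J : n * Q * J / sigma ^+ 2 * Lg = n * (c * J).
  by rewrite /c; ring.
(* [M p_J <= 7 c J p_J <= xi / 4] as soon as [J p_J <= e] *)
pose e := xi / 4 / (7 * c).
have e0 : 0 < e by rewrite !divr_gt0// mulr_gt0.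
suff [J [core J1 cJ pJ]] : exists J, [/\ forall M,
    6 * Q * J / sigma ^+ 2 * ln (4 * N%:R / xi) <= M%:R ->
    forall d' (Omega : measurableType d') (P : probability Omega R)
      (X : 'I_M -> {RV P >-> T}),
    independent_samples rho X ->
    exists A : set Omega, [/\ measurable A, (P A <= (3 / 4 * xi)%:E)%E
      & forall w, ~ A w -> let G := empirical_gram sample_gram (fun m => X m w) in
          G \in unitmx /\
          nsq (coefs *m invmx G - coefs) <= sigma ^+ 2 / J * nsq coefs],
    1 <= J, 1 <= c * J & J * fine (rho (tail_set s J)) <= e].
  have J0 : 0 < J by rewrite (lt_le_trans ltr01).
  pose M := (Num.truncn (6 * (c * J))).+1.
  have /andP[M1 M2] : 6 * (c * J) <= M%:R <= 7 * (c * J).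
    rewrite /M (ltW (truncnS_gt _)) -natr1 /=.
    have : (Num.truncn (6 * (c * J)))%:R <= 6 * (c * J) by rewrite truncn_le//; lra.
    lra.
  exists J, M; split=> //; [by rewrite EJ|by rewrite EJ|].
  move=> d' Omega P X ind; have [|A [mA PA hA]] := core M _ d' Omega P X ind.
    by rewrite -/Lg EJ.
  pose B := (~` D0) `|` tail_set s J.
  have mB : measurable B.
    apply: measurableU; last exact: measurable_tail_set.
    by apply: measurableC; exact: measurable_good_set.
  have mXB m : measurable (X m @^-1` B).
    by rewrite -[X in measurable X]setTI; apply: measurable_funPT.
  pose Bad := A `|` \big[setU/set0]_m (X m @^-1` B).
  have mBad : measurable Bad by apply: measurableU => //; exact: bigsetU_measurable.
  have PBad : (P Bad <= xi%:E)%E.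
    apply: (le_trans (measureU2 _ _ _)) => //; first exact: bigsetU_measurable.
    have -> : xi = 3 / 4 * xi + xi / 4 by lra.
    rewrite EFinD; apply: leeD => //.
    apply: (le_trans (measure_bigsetU_le _ _ mXB)).
    have rB : (rho B <= (fine (rho (tail_set s J)))%:E)%E.
      rewrite fineK ?fin_num_measure//; last exact: measurable_tail_set.
      apply: (le_trans (measureU2 _ _ _)).
      - by apply: measurableC; exact: measurable_good_set.
      - exact: measurable_tail_set.
      - by rewrite [X in (X + _)%E](_ : _ = 0%E) ?add0e//; exact: rho_good_setC.
    apply: (@le_trans _ _ (\sum_(m < M) (fine (rho (tail_set s J)))%:E)%E).
      apply: lee_sum => m _; apply: le_trans rB.
      by rewrite -(ind.1 m B mB).
    rewrite sumEFin sumr_const card_ord lee_fin -[leLHS]mulr_natl.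
    set p := fine _ in pJ *.
    have p0 : 0 <= p by exact: fine_ge0.
    apply: (@le_trans _ _ (7 * (c * J) * p)); first by rewrite ler_wpM2r.
    have -> : 7 * (c * J) * p = J * p * (7 * c) by ring.
    by rewrite -ler_pdivlMr// mulr_gt0.
  exists (~` Bad); split; first exact: measurableC.
  - move=> w nBad x.
    have Dx m : D0 (x m) /\ ~ tail_set s J (x m).
      have nB : ~ B (x m) by move=> Bm; apply: nBad; right; rewrite (bigD1 m)//=; left.
      split=> [|h]; last by apply: nB; right.
      by apply: contrapT => h; apply: nB; left.
    have [|] := hA w; first by move=> Aw; apply: nBad; left.
    rewrite -/x -gram_sample_gram => [uG hG|m]; last by case: (Dx m).
    split=> // [|m]; first exact: ls_rule_exact.
    apply: ls_weight_close hG _ => //; first by case: (Dx m).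
    apply: not_tail_set; last exact: ltW.
      by case: (Dx m) => /good_set_subset.
    by case: (Dx m).
  - rewrite probability_setC// EFinB; apply: leeB => //.
near +oo_R => J.
exists J; split.
- near: J. exact: coefs_concentration.
- near: J; apply: nbhs_pinfty_ge; exact: num_real.
- rewrite -ler_pdivrMl// mulr1; near: J; apply: nbhs_pinfty_ge; exact: num_real.
- near: J. 
  have /cvgrPdist_lt/(_ _ e0) := tail_set_small adm.
  apply: filterS => J; rewrite sub0r normrN => h.
  exact: le_trans (ler_norm _) (ltW h).
Unshelve. all: by end_near. Qed.

End ChristoffelWeighting.

Theorem theorem2p4 (R : realType) (E : completeNormedModType R)
  (G : set (set E)) (hG : contains_borel G)
  (mu : {measure set (g_sigma_algebraType G) -> \bar R})
  (D : set (g_sigma_algebraType G)) (hD : is_closed_support mu D)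
  (N : nat) (hN : (0 < N)%N)
  (phi : 'I_N -> g_sigma_algebraType G -> R[i])
  (hL2 : forall n, L2 mu D (phi n)) (hphi : orthonormal_family phi mu D)
  (tau2 : g_sigma_algebraType G -> R)
  (htau_ge0 : forall x, D x -> 0 <= tau2 x)
  (htau_meas : measurable_fun D tau2)
  (htau_int : (\int[mu]_(x in D) (tau2 x)%:E = 1)%E)
  (hcov : coverage phi mu D tau2)
  (rho : probability (g_sigma_algebraType G) R)
  (hrho : is_density mu D rho tau2)
  (F : (g_sigma_algebraType G -> R[i]) -> R[i])
  (hF : linear_on_span phi F)
  (s : mode) (hadm : admissible phi F s mu D rho tau2)
  (sigma xi : R) (hsigma : 0 < sigma) (hxi0 : 0 < xi) (hxi1 : xi < 1) :
  exists (J : R) (M : nat),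
    [/\ 1 <= J,
        6 * fine (Qsup phi rho tau2) * J / sigma ^+ 2 * ln (4 * N%:R / xi)
          <= M%:R,
        M%:R <=
          7 * fine (Qsup phi rho tau2) * J / sigma ^+ 2 * ln (4 * N%:R / xi)
      & forall (d' : measure_display) (Omega : measurableType d')
          (P : probability Omega R)
          (X : 'I_M -> {RV P >-> g_sigma_algebraType G}),
          independent_samples rho X ->
          with_probability_at_least P (1 - xi)
            [set w | let x := fun m => X m w in
              [/\ ls_well_defined phi tau2 x,
                  exact_on_span phi F tau2 x
                & forall m,
                    normc (M%:R * ls_weight phi F tau2 x m
                           - omega phi F tau2 (x m))
                      <= sigma * Xi phi F s tau2 (x m)]]].
Proof.
have [cD _ _] := hD.
have mD : measurable D.
  by rewrite -[D]setCK; apply: measurableC; apply: hG; exact: closed_openC.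
have Qfin : (Qsup phi rho tau2 < +oo)%E by case: s hadm => [[]|[]].
exact: (christoffel_quadrature mD htau_ge0 htau_meas hrho (fun n => (hL2 n).1)
  hcov Qfin hphi hN hF hadm hsigma hxi0 hxi1).
Qed.
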